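(* Let $Z$ be a real Hilbert space, $X\subset Z$ a linear subspace, $U,Y$ real Hilbert spaces, and let $\mathcal{A}:X\to Z$, $\mathcal{B}_1:\mathbb{R}^{n_\omega}\to Z$, $\mathcal{B}_2:U\to Z$, $\mathcal{C}_1:X\to\mathbb{R}^{p}$, $\mathcal{C}_2:X\to Y$, $\mathcal{C}_3:X\to\mathbb{R}^{p_1}$, $\mathcal{D}_1:\mathbb{R}^{n_\omega}\to\mathbb{R}^{p}$, $\mathcal{D}_2:\mathbb{R}^{n_\omega}\to Y$, $\mathcal{D}_3:\mathbb{R}^{n_\omega}\to\mathbb{R}^{p_1}$ be linear operators. Suppose there exist positive scalars $\epsilon_1,\epsilon_2,\gamma_1,\gamma_2$ and operators $\mathcal{P}_1,\mathcal{P}_2,\mathcal{H},\mathcal{Z}$ such that the following hold. (1) $\mathcal{P}_1:Z\to Z$ is a bounded, coercive linear operator which is self-adjoint with respect to the inner product of $Z$ and satisfies $\mathcal{P}_1(X)=X$; and $\mathcal{H}:X\to U$ is a linear operator such that, for all $\mathbf{h}\in X$, $\omega\in\mathbb{R}^{n_\omega}$, $\upsilon\in\mathbb{R}^{p}$, $$\begin{aligned} &\langle \mathcal{A}\mathcal{P}_1\mathbf{h},\mathbf{h}\rangle_Z+\langle \mathbf{h},\mathcal{A}\mathcal{P}_1\mathbf{h}\rangle_Z+\langle \mathcal{B}_2\mathcal{H}\mathbf{h},\mathbf{h}\rangle_Z+\langle \mathbf{h},\mathcal{B}_2\mathcal{H}\mathbf{h}\rangle_Z+\langle \mathcal{B}_1\omega,\mathbf{h}\rangle_Z+\langle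 \mathbf{h},\mathcal{B}_1\omega\rangle_Z\\ &\quad-\gamma_1\|\omega\|^2-\gamma_1\|\upsilon\|^2+\upsilon^T(\mathcal{C}_1\mathcal{P}_1\mathbf{h})+(\mathcal{C}_1\mathcal{P}_1\mathbf{h})^T\upsilon+\upsilon^T(\mathcal{D}_1\omega)+(\mathcal{D}_1\omega)^T\upsilon\le-\epsilon_1\|\mathbf{h}\|_Z^2 . \end{aligned}$$ (2) $\mathcal{P}_2:Z\to Z$ and $\mathcal{Z}:Y\to Z$ are bounded linear operators, $\mathcal{P}_2$ is coercive, and, for all $\mathbf{e}\in X$, $\omega\in\mathbb{R}^{n_\omega}$, $\upsilon_e\in\mathbb{R}^{p_1}$, $$\begin{aligned} &\langle (\mathcal{P}_2\mathcal{A}+\mathcal{Z}\mathcal{C}_2)\mathbf{e},\mathbf{e}\rangle_Z+\langle \mathbf{e},(\mathcal{P}_2\mathcal{A}+\mathcal{Z}\mathcal{C}_2)\mathbf{e}\rangle_Z-\langle \mathbf{e},(\mathcal{P}_2\mathcal{B}_1+\mathcal{Z}\mathcal{D}_2)\omega\rangle_Z-\langle (\mathcal{P}_2\mathcal{B}_1+\mathcal{Z}\mathcal{D}_2)\omega,\mathbf{e}\rangle_Z\\ &\quad-\gamma_2\|\omega\|^2-\gamma_2\|\upsilon_e\|^2+\langle \upsilon_e,\mathcal{C}_3\mathbf{e}\rangle+\langle \mathcal{C}_3\mathbf{e},\upsilon_e\rangle+\langle \upsilon_e,\mathcal{D}_3\omega\rangle+\langle \mathcal{D}_3\omega,\upsilon_e\rangle\le-\epsilon_2\|\mathbf{e}\|_Z^2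 . \end{aligned}$$ (3) There exists a scalar $r>0$ such that, for all $\mathbf{h},\mathbf{e}\in X$, $$\left\langle \begin{bmatrix}\mathbf{h}\\ \mathbf{e}\end{bmatrix},\mathcal{M}\begin{bmatrix}\mathbf{h}\\ \mathbf{e}\end{bmatrix}\right\rangle\le 0,\qquad \mathcal{M}=\begin{bmatrix}-\epsilon_1 I & \mathcal{B}_2\mathcal{H}\mathcal{P}_1^{-1}\\ (\mathcal{B}_2\mathcal{H}\mathcal{P}_1^{-1})^{*} & -r\epsilon_2 I\end{bmatrix},$$ that is, $-\epsilon_1\|\mathbf{h}\|_Z^2+\langle \mathbf{h},\mathcal{B}_2\mathcal{H}\mathcal{P}_1^{-1}\mathbf{e}\rangle_Z+\langle \mathcal{B}_2\mathcal{H}\mathcal{P}_1^{-1}\mathbf{e},\mathbf{h}\rangle_Z-r\epsilon_2\|\mathbf{e}\|_Z^2\le 0$. Set $\mathcal{K}=\mathcal{H}\mathcal{P}_1^{-1}$ and $\mathcal{L}=\mathcal{P}_2^{-1}\mathcal{Z}$. Then for any $\omega\in L_2$ and any $\mathbf{x},\mathbf{e},z,\mathbf{y},z_e$ satisfying $$\begin{aligned} \dot{\mathbf{x}}(t)&=(\mathcal{A}+\mathcal{B}_2\mathcal{K})\mathbf{x}(t)+\mathcal{B}_1\omega(t)+\mathcal{B}_2\mathcal{K}\mathbf{e}(t),\\ \dot{\mathbf{e}}(t)&=(\mathcal{A}+\mathcal{L}\mathcal{C}_2)\mathbf{e}(t)-(\mathcal{B}_1+\mathcal{L}\mathcal{D}_2)\omega(t),\\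 z(t)&=\mathcal{C}_1\mathbf{x}(t)+\mathcal{D}_1\omega(t),\\ \mathbf{y}(t)&=\mathcal{C}_2\mathbf{x}(t)+\mathcal{D}_2\omega(t),\\ z_e(t)&=\mathcal{C}_3\mathbf{e}(t)+\mathcal{D}_3\omega(t),\\ \mathbf{x}(0)&=\mathbf{e}(0)=0, \end{aligned}$$ one has $$\|z\|_{L_2}\le\sqrt{\gamma_1(\gamma_1+r\gamma_2)}\,\|\omega\|_{L_2}\qquad\text{and}\qquad \|z_e\|_{L_2}\le\gamma_2\|\omega\|_{L_2}.$$
   Context: An operator $\mathcal{P}:Z\to Z$ is coercive on a subset $S$ of $Z$ if there is $\epsilon>0$ with $\langle x,\mathcal{P}x\rangle_Z\ge\epsilon\|x\|_Z^2$ for all $x\in S$; ''coercive'' without qualification means coercive on $Z$. A bounded coercive operator on $Z$ has a bounded inverse, so $\mathcal{P}_1^{-1}$ and $\mathcal{P}_2^{-1}$ are well defined; since $\mathcal{P}_1(X)=X$, also $\mathcal{P}_1^{-1}:X\to X$. Solutions of the closed-loop system are functions $\mathbf{x},\mathbf{e}:[0,\infty)\to X$, differentiable as functions into $Z$, satisfying the displayed equations. The norm $\|\cdot\|_{L_2}$ is the norm of square-integrable (Euclidean-vector-valued) functions on $[0,\infty)$. Finite-dimensional norms and inner products are Euclidean. Interpretation: the plant is $\dot{\mathbf{x}}=\mathcal{A}\mathbf{x}+\mathcal{B}_1\omega+\mathcal{B}_2u$ with regulated output $z$ and measured output $\mathbf{y}$; the estimator is $\dot{\hat{\mathbf{x}}}=\mathcal{A}\hat{\mathbf{x}}+\mathcal{B}_2u+\mathcal{L}(\mathcal{C}_2\hat{\mathbf{x}}-\mathbf{y})$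 with $u=\mathcal{K}\hat{\mathbf{x}}$; the error is $\mathbf{e}=\hat{\mathbf{x}}-\mathbf{x}$.
   Formalization: The operator $\mathcal{P}_2$ in (2) is additionally assumed self-adjoint with respect to the inner product of $Z$; without this the claim is false (e.g. on $\mathbb{R}^2$ with $\mathcal{P}_2=I+2J$, $\mathcal{A}=\frac35 I+\frac45 J$, $J$ the rotation by 90 degrees). *)

(* Defs.v *)
From HB Require Import structures.
From mathcomp Require Export all_boot all_order all_algebra.
From mathcomp Require Export all_classical all_reals all_analysis.
Export Order.TTheory GRing.Theory Num.Theory numFieldNormedType.Exports.

Set Implicit Arguments.
Unset Strict Implicit.
Unset Printing Implicit Defensive.

Local Open Scope classical_set_scope.
Local Open Scope ring_scope.

(* A real Hilbert space is a complete normed module over a realType whose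
   norm comes from an inner product; linearity in the second argument follows
   from symmetry. *)
HB.mixin Record NormedModule_hasInner (R : realType) V
    of NormedModule R V := {
  inner : V -> V -> R ;
  innerC : forall x y : V, inner x y = inner y x ;
  innerPl : forall (a : R) (x y z : V),
    inner (a *: x + y) z = a * inner x z + inner y z ;
  innerxx : forall x : V, inner x x = `|x| ^+ 2
}.

#[short(type="hilbertType")]
HB.structure Definition Hilbert (R : realType) :=
  {V of CompleteNormedModule R V & NormedModule_hasInner R V}.

Reserved Notation "''<' u , v >" (at level 0, u at level 69, v at level 69,
  format "''<' u ,  v >").
Notation "''<' u , v >" := (inner u v) : ring_scope.

(* The library norm on column vectors is the sup norm, so the Euclidean
   structure on R^n is introduced separately. *)
Definition dotcv (R : realType) (n : nat) (u v : 'cV[R]_n) : R :=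
  \sum_(i < n) u i ord0 * v i ord0.

Definition enorm (R : realType) (n : nat) (u : 'cV[R]_n) : R :=
  Num.sqrt (dotcv u u).

Section Operators.
Context {R : realType}.

(* A linear operator X -> W, with X a subspace of V, is encoded as a function
   on V that is linear on X; its values outside X are irrelevant. *)
Definition linear_on (V W : lmodType R) (X : {pred V}) (f : V -> W) : Prop :=
  forall (a : R) (u v : V), u \in X -> v \in X ->
    f (a *: u + v) = a *: f u + f v.

Definition bounded_op (V W : normedModType R) (f : V -> W) : Prop :=
  exists M : R, forall x : V, `|f x| <= M * `|x|.

Definition coercive_on (Z : hilbertType R) (S : set Z) (P : Z -> Z) : Prop :=
  exists2 eps : R, 0 < eps & forall x : Z, S x -> eps * `|x| ^+ 2 <= '<x, P x>.

Definition coercive (Z : hilbertType R) (P : Z -> Z) : Prop :=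
  coercive_on setT P.

Definition self_adjoint (Z : hilbertType R) (P : Z -> Z) : Prop :=
  forall x y : Z, '<P x, y> = '<x, P y>.

(* The two-sided inverse when P is bijective, in particular when P is bounded,
   linear and coercive. *)
Definition op_inv (Z : hilbertType R) (P : Z -> Z) : Z -> Z :=
  'pinv_(fun=> 0) setT P.

(* The derivative relative to the half-line [0, +oo[: two-sided at t > 0,
   one-sided at t = 0. *)
Definition has_deriv_ge0 (V : normedModType R) (f : R -> V) (t : R) (v : V)
    : Prop :=
  (s - t)^-1 *: (f s - f t) @[s --> within [set s | 0 <= s] t^'] --> v.

End Operators.

Section SquareIntegrable.
Context {R : realType} {n : nat}.

Definition L2norm (f : R -> 'cV[R]_n) : \bar R :=
  'N[@lebesgue_measure R]_(2%:E)
    [(EFin \o (fun t => enorm (f t))) \_ `[0, +oo[].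

(* The library sigma-algebra on R is the Borel one, so Lebesgue measurability
   is expressed as almost-everywhere equality with a Borel function. *)
Definition lebesgue_measurable_fun (D : set R) (f : R -> R) : Prop :=
  exists2 g : R -> R, measurable_fun D g & ae_eq (@lebesgue_measure R) D f g.

Definition in_L2 (f : R -> 'cV[R]_n) : Prop :=
  (forall i : 'I_n, lebesgue_measurable_fun `[0, +oo[ (fun t => f t i ord0))
  /\ (L2norm f < +oo)%E.

End SquareIntegrable.

(* Main.v *)
(* With the storage functions <x, P1^-1 x> and <e, P2 e>, maximizing (1) and (2)
   over the multipliers and bounding the coupling term by (3) gives
     d/dt <e, P2 e> <= gamma2 |w|^2 - |ze|^2 / gamma2,
     d/dt (<x, P1^-1 x> + r <e, P2 e>)
       <= (gamma1 + r gamma2) |w|^2 - |z|^2 / gamma1,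
   and both bounds follow by integration, as the storage functions vanish at 0
   and stay nonnegative.

   Integration: the derivatives exist everywhere but need not be integrable, and
   |z|^2 is not known to be integrable beforehand.  Truncating |z|^2 turns the
   right-hand side into an integrable function bounded below; such a one-sided
   bound on the derivative, even if valid almost everywhere only, suffices.

   Measurability of z: C1 need not be bounded, but (1) makes it bounded for the
   semi-inner product - <G u, P1^-1 k> - <G k, P1^-1 u>, with G = A + B2 K, so
   C1 x(t) is a pointwise limit of its values at (k_n, x(t)).  These values are
   measurable, as G x(t) differs from the derivative of x by input and coupling
   terms.  The same argument applies to C3 e, with G = P2 A + Z C2. *)

Require Import Defs.
From mathcomp Require Import all_boot all_order all_algebra.
From mathcomp Require Import all_classical all_reals all_analysis.
From mathcomp Require Import measurable_realfun ring lra.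

Import Order.TTheory GRing.Theory Num.Theory.

Set Implicit Arguments.
Unset Strict Implicit.
Unset Printing Implicit Defensive.

Local Open Scope classical_set_scope.
Local Open Scope ring_scope.

(** * Inner products and coercive operators *)

Section InnerProduct.
Context {R : realType} {Z : hilbertType R}.
Implicit Types (x y z : Z) (a : R).

Lemma innerDl x y z : '<x + y, z> = '<x, z> + '<y, z>.
Proof. by rewrite -[x in LHS]scale1r innerPl mul1r. Qed.

Lemma inner0l z : '<0, z> = 0.
Proof. by apply: (addIr '<0, z>); rewrite -innerDl !add0r. Qed.

Lemma innerZl a x z : '<a *: x, z> = a * '<x, z>.
Proof. by rewrite -[a *: x]addr0 innerPl inner0l addr0. Qed.

Lemma innerNl x z : '<- x, z> = - '<x, z>.
Proof. by rewrite -scaleN1r innerZl mulN1r. Qed.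

Lemma innerBl x y z : '<x - y, z> = '<x, z> - '<y, z>.
Proof. by rewrite innerDl innerNl. Qed.

Lemma innerDr x y z : '<z, x + y> = '<z, x> + '<z, y>.
Proof. by rewrite innerC innerDl !(innerC z). Qed.

Lemma innerNr x z : '<z, - x> = - '<z, x>.
Proof. by rewrite innerC innerNl (innerC z). Qed.

Lemma innerZr a x z : '<z, a *: x> = a * '<z, x>.
Proof. by rewrite innerC innerZl (innerC z). Qed.

Lemma innerBr x y z : '<z, x - y> = '<z, x> - '<z, y>.
Proof. by rewrite innerDr innerNr. Qed.

Lemma inner_polarization x y :
  '<x, y> = 4^-1 * (`|x + y| ^+ 2 - `|x - y| ^+ 2).
Proof.
rewrite -!innerxx !(innerDl, innerDr, innerNl, innerNr) (innerC y x).
by field.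
Qed.

Lemma ler_inner_norm x y : '<x, y> <= `|x| * `|y|.
Proof.
have [->|x0] := eqVneq x 0; first by rewrite inner0l normr0 mul0r.
have [->|y0] := eqVneq y 0; first by rewrite innerC inner0l normr0 mulr0.
have nx : 0 < `|x| by rewrite normr_gt0.
have ny : 0 < `|y| by rewrite normr_gt0.
(* Expanded, this square is [2 |x| |y| (|x| |y| - <x, y>)]; dividing by the positive factor
   [|x| |y|] gives Cauchy-Schwarz. *)
have : 0 <= `| `|y| *: x - `|x| *: y| ^+ 2 by rewrite sqr_ge0.
rewrite -innerxx innerBl !innerBr !innerZl !innerZr !innerxx (innerC y x).
set s := '<x, y> => h.
have {}h : 0 <= `|x| * `|y| * (`|x| * `|y| - s) by lra.
by move: h; rewrite pmulr_rge0 ?mulr_gt0// subr_ge0.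
Qed.

Lemma ler_norm_inner x y : `|'<x, y>| <= `|x| * `|y|.
Proof.
rewrite ler_norml ler_inner_norm andbT lerNl -innerNl.
by rewrite -[`|x|]normrN ler_inner_norm.
Qed.

(** Polarization reduces joint continuity of the inner product to continuity of the norm. *)
Lemma cvg_inner (T : Type) (F : set_system T) {FF : Filter F} (f g : T -> Z)
    (x y : Z) :
  f @ F --> x -> g @ F --> y -> '<f t, g t> @[t --> F] --> '<x, y>.
Proof.
move=> fx gy; rewrite inner_polarization.
under eq_fun do rewrite inner_polarization.
apply: cvgMl_tmp; apply: cvgB; apply: cvgM; apply: cvg_norm;
  by [apply: cvgD|apply: cvgB].
Qed.

End InnerProduct.

Section Riesz.
Context {R : realType} {V : lmodType R} (X : submodClosed V).
Variables (a : V -> V -> R) (f : V -> R) (c : R).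
Hypothesis aC : forall x y, a x y = a y x.
Hypothesis alin : forall y, y \in X -> linear_on X (a ^~ y : V -> R^o).
Hypothesis flin : linear_on X (f : V -> R^o).
Hypothesis f_le : forall x, x \in X -> f x ^+ 2 <= c * a x x.

(* A minimizing sequence of [k |-> a k k - 2 f k] represents [f] weakly with
   respect to the semi-inner product [a]; no completeness is needed. *)
Lemma riesz_sequence : (forall x, x \in X -> 0 <= a x x) -> 0 <= c ->
  exists2 k : nat -> V, (forall n, k n \in X) &
    forall x, x \in X -> a (k n) x @[n --> \oo] --> f x.
Proof.
move=> a_ge0 c0; pose J k := a k k - 2 * f k.
pose S := [set J k | k in [set` X]].
have S0 : S !=set0 by exists (J 0), 0 => //=; exact: rpred0.
(* Young's inequality [2 |f k| <= a k k + c], from [f k ^+ 2 <= c * a k k], bounds [J] below. *)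
have Jge k : k \in X -> - c <= J k.
  move=> kX; have := f_le kX; have := a_ge0 _ kX.
  rewrite /J; set A := a k k; set p := f k => A0 pA.
  have : `|2 * p| <= A + c.
    rewrite -[leRHS]ger0_norm ?addr_ge0// -ler_sqr ?nnegrE//.
    rewrite !real_normK ?num_real//.
    have := sqr_ge0 (A - c); nra.
  by have := ler_norm (2 * p); lra.
have infS : has_inf S.
  by split => //; exists (- c) => _ [k /= kX <-]; exact: Jge.
have Jinf k : k \in X -> inf S <= J k.
  by move=> kX; apply: ge_inf; [exact: infS.2|exists k].
have /choice[k Hk] n : exists k, k \in X /\ J k < inf S + n.+1%:R^-1.
  have n0 : 0 < n.+1%:R^-1 :> R by rewrite invr_gt0.
  have [_ [k /= kX <-] Jk] := inf_adherent n0 infS.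
  by exists k.
exists k => [n|x xX]; first by case: (Hk n).
have a2 u v y : u \in X -> v \in X -> y \in X ->
    forall s, a (s *: u + v) y = s * a u y + a v y.
  by move=> uX vX yX s; have := alin yX s uX vX.
(* Near-minimality of [k n] is tested at [k n + s x], where [J] changes by [2 s d + s^2 A]. The step
   [s = - d / (A + 1)] is the optimal one with [A] raised by one, which keeps the division safe when
   [A = 0]. *)
have key n : (a (k n) x - f x) ^+ 2 <= n.+1%:R^-1 * (a x x + 1).
  have [kX Jk] := Hk n.
  set d := a (k n) x - f x; set A := a x x.
  have A0 : 0 <= A by exact: a_ge0.
  have dX s : s *: x + k n \in X by rewrite rpredD// rpredZ.
  have := Jinf _ (dX (- d / (A + 1))).
  rewrite /J; set s := - d / (A + 1).
  rewrite (a2 x (k n))// ![a _ (s *: x + k n)]aC !(a2 x (k n))//.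
  have -> : f (s *: x + k n) = s * f x + f (k n) by have := flin s xX kX.
  have sE : s * (A + 1) = - d by rewrite /s mulfVK// gt_eqF// ltr_wpDl.
  move: Jk; rewrite /J [a x (k n)]aC -/A => Jk hJ.
  set e := n.+1%:R^-1 in Jk *.
  have e0 : 0 < e by rewrite invr_gt0.
  have hd : 0 < 2 * s * d + s ^+ 2 * A + e by rewrite /d; lra.
  have dE : d = - (s * (A + 1)) by rewrite sE opprK.
  have : s ^+ 2 * (A + 2) < e by move: hd; rewrite dE; nra.
  by rewrite dE; nra.
apply/cvgrPdist_le => e e0.
have eA : 0 < e ^+ 2 / (a x x + 1).
  by rewrite divr_gt0 ?exprn_gt0// ltr_wpDl// a_ge0.
near=> n.
rewrite distrC -ler_sqr ?nnegrE ?(ltW e0)// real_normK ?num_real//.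
apply: le_trans (key n) _; rewrite -ler_pdivlMr ?ltr_wpDl ?a_ge0//.
apply: ltW; near: n; exact: (near_infty_natSinv_lt (PosNum eA)).
Unshelve. all: by end_near. Qed.
End Riesz.

Section CoerciveSurjective.
Context {R : realType} {Z : hilbertType R}.
Variable P : {linear Z -> Z}.

Lemma coercive_inj : coercive P -> injective P.
Proof.
case=> eps eps0 H x y Pxy; apply/eqP; rewrite -subr_eq0 -normr_eq0 -sqrf_eq0.
have := H (x - y) I; rewrite linearB /= Pxy subrr innerC inner0l.
by rewrite pmulr_rle0// => h; rewrite eq_le h sqr_ge0.
Qed.

(* Lax-Milgram: for small [s > 0] the map [x |-> x - s (P x - z)] contracts. *)
Lemma coercive_surj z : bounded_op P -> coercive P -> exists x, P x = z.
Proof.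
case=> M HM [eps eps0 H].
pose N := `|M| + eps + 1.
have N0 : 0 < N by rewrite /N -addrA ltr_wpDl// addr_gt0.
(* This [s] minimizes [1 - 2 s eps + s^2 N^2], a bound for the squared contraction factor; the
   minimum is [q2], nonnegative because [eps <= N]. *)
pose s := eps / N ^+ 2.
have s0 : 0 < s by rewrite divr_gt0 ?exprn_gt0.
pose q2 := 1 - s * eps.
have q21 : q2 < 1 by rewrite gtrDl oppr_lt0 mulr_gt0.
have q20 : 0 <= q2.
  rewrite subr_ge0 /s mulrAC ler_pdivrMr ?exprn_gt0// mul1r.
  rewrite -expr2 ler_sqr ?nnegrE ?ltW//.
  by have := normr_ge0 M; rewrite /N; lra.
have contr x : `|x - s *: P x| <= Num.sqrt q2 * `|x|.
  rewrite -ler_sqr ?nnegrE ?mulr_ge0 ?sqrtr_ge0// exprMn sqr_sqrtr//.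
  rewrite -innerxx innerBl !innerBr !innerZl !innerZr !innerxx (innerC (P x)).
  have := H x I; set t := '<x, P x> => ht.
  have : `|P x| ^+ 2 <= N ^+ 2 * `|x| ^+ 2.
    rewrite -exprMn ler_sqr ?nnegrE ?mulr_ge0 ?(ltW N0)//.
    apply: le_trans (HM x) _; rewrite ler_wpM2r//.
    by rewrite (le_trans (ler_norm M))// /N -addrA lerDl addr_ge0// ltW.
  rewrite /q2 => hP.
  have sN : s * N ^+ 2 = eps by rewrite /s mulfVK// gt_eqF ?exprn_gt0.
  have : s * `|P x| ^+ 2 <= eps * `|x| ^+ 2.
    by rewrite -sN -mulrA ler_wpM2l// ltW.
  set u := `|P x| ^+ 2; set v := `|x| ^+ 2 => hu.
  have : s * (s * u) <= s * (eps * v) by rewrite ler_wpM2l// ltW.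
  have : s * (eps * v) <= s * t by rewrite ler_wpM2l// ltW.
  lra.
pose f : Z -> Z := fun x => x - s *: (P x - z).
pose F : {fun [set: Z] >-> [set: Z]} := totalfun f.
have cF : is_contraction F.
  exists (NngNum (sqrtr_ge0 q2)); split => /=.
    by rewrite -[ltRHS]sqrtr1 ltr_sqrt// ltr01.
  move=> [x y] _ /=.
  have -> : f x - f y = (x - y) - s *: P (x - y).
    have fE u : f u = s *: z + (u - s *: P u).
      by rewrite /f scalerBr opprB addrCA.
    rewrite !fE opprD addrACA subrr add0r (linearB P) scalerBr !opprB.
    by rewrite [s *: P y - y]addrC addrACA [- (s *: P x) + _]addrC.
  exact: contr.
have [p _ pE] := banach_fixed_point cF closedT (ex_intro _ 0 I).
exists p; apply/eqP; rewrite -subr_eq0.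
have : s *: (P p - z) = 0.
  apply/eqP; rewrite -oppr_eq0; apply/eqP.
  by apply: (addrI p); rewrite addr0 {3}pE.
by move/eqP; rewrite scaler_eq0 gt_eqF.
Qed.

End CoerciveSurjective.

(** * Integrating a one-sided bound on the derivative *)

Section RightGrowth.
Context {R : realType}.
Notation mu := (@lebesgue_measure R).

(** Continuous induction: let [m] be the supremum of the times up to which the bound holds. The left
    condition gives the bound at [m], and the right condition carries it past [m] unless [m = T].
    The left condition tolerates downward jumps of [f], such as those of minus a monotone
    function. *)
Lemma right_growth_le (f : R -> R) (T c : R) : 0 <= T -> 0 <= c ->
  (forall t, 0 <= t < T -> \forall s \near t^'+, f s - f t <= c * (s - t)) ->
  (forall t e, 0 < t <= T -> 0 < e -> \forall s \near t^'-, f t <= f s + e) ->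
  f T <= f 0 + c * T.
Proof.
move=> T0 c0 fr fl.
pose S := [set t | 0 <= t <= T /\ forall s, 0 <= s <= t -> f s <= f 0 + c * s].
have S0 : S 0.
  by split=> [|s /le_anti <-]; rewrite ?lexx// mulr0 addr0.
have hS : has_sup S by split; [exists 0|exists T => t [/andP[]]].
pose m := sup S.
have Sm t : S t -> t <= m by move=> St; apply: (ub_le_sup hS.2).
have m0 : 0 <= m by exact: Sm.
have mT : m <= T by apply: ge_sup; [exists 0|move=> t [/andP[]]].
have ltm s : 0 <= s < m -> f s <= f 0 + c * s.
  move=> /andP[s0 sm]; have ms : 0 < m - s by rewrite subr_gt0.
  have [t [_ St]] := sup_adherent ms hS.
  by rewrite subKr => st; apply: St; rewrite s0 ltW.
have fm : f m <= f 0 + c * m.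
  have [->|mn0] := eqVneq m 0; first by rewrite mulr0 addr0.
  have m1 : 0 < m by rewrite lt_neqAle eq_sym mn0.
  apply/ler_addgt0Pr => e e0.
  near (m^'-) => s.
  have sm : s < m by [].
  have s0 : 0 <= s by near: s; exact: nbhs_left_ge.
  have : f m <= f s + e by near: s; apply: fl => //; rewrite m1.
  have : f s <= f 0 + c * s by apply: ltm; rewrite s0.
  have : c * s <= c * m by rewrite ler_wpM2l// ltW.
  lra.
have [<-//|mnT] := eqVneq m T.
have {}mT : m < T by rewrite lt_neqAle mnT.
have [d /= d0 fd] : \forall s \near m^'+, f s - f m <= c * (s - m).
  by apply: fr; rewrite m0.
pose b := Num.min d (T - m) / 2.
have b0 : 0 < b by rewrite divr_gt0// lt_min d0 subr_gt0.
have bd : b < d by rewrite ltr_pdivrMr// gt_min ltr_pMr// ltr1n.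
have bT : b <= T - m.
  by rewrite ler_pdivrMr// ge_min ler_peMr ?orbT ?ler1n// subr_ge0 ltW.
have /Sm : S (m + b); last by rewrite leNgt ltrDl b0.
split=> [|s /andP[s0 sb]]; first by apply/andP; lra.
have [sm|ms|->//] := ltgtP s m; first by apply: ltm; rewrite s0.
have : f s - f m <= c * (s - m).
  by apply: fd => //=; rewrite /ball/= ltr0_norm ?subr_lt0//; lra.
lra.
Unshelve. all: by end_near. Qed.

(** Cover the null set by open sets [V k] of measure at most [2^-(k+1)], and sum over [k] the
    measure of the part of [V k] to the left of [x]. The sum is at most 1, and near a point of [N]
    any finite number of the [V k] contribute slope one each, so the right derivative is infinite
    there. *)
Lemma negligible_growth (N : set R) : mu.-negligible N ->
  exists2 g : R -> R, nondecreasing g /\ (forall x, 0 <= g x <= 1) &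
    forall t c, N t -> \forall s \near t^'+, c * (s - t) <= g s - g t.
Proof.
move=> [B' [mB' B0' NB]]; pose B : set R := B'.
have mB : measurable B by [].
have B0 : mu B = 0%E by [].
have /choice[V HV] k : exists V : set R, [/\ open V, B `<=` V &
    (mu V <= (1 / (2 ^ k.+1)%:R)%:E)%E].
  have [|//|V [oV BV mV]] :=
      lebesgue_regularity_outer (eps := 1 / (2 ^ k.+1)%:R) mB.
    by rewrite [ltLHS](_ : _ = 0%E) ?ltry.
  exists V; split => //.
  have mV' : measurable V by exact: open_measurable.
  rewrite -(classical_sets.setDUK BV).
  apply: (le_trans (measureU2 _ _ _)) => //; first exact: measurableD.
  by rewrite [X in (X + _)%E](_ : _ = 0%E)// add0e ltW.
have le_mu (A C : set R) : measurable A -> measurable C -> A `<=` C ->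
    (mu A <= mu C)%E.
  by move=> mA mC AC; apply: le_measure; rewrite ?inE.
have oV k : open (V k) by case: (HV k).
have mV k : measurable (V k) by exact: open_measurable.
pose a k x := mu (V k `&` `]-oo, x]).
pose W x := (\sum_(0 <= k <oo) a k x)%E.
have a0 k x : (0 <= a k x)%E by [].
have mVx k x : measurable (V k `&` `]-oo, x]) by exact: measurableI.
have W1 x : (W x <= 1)%E.
  apply: le_trans (epsilon_trick0 xpredT ler01).
  apply: lee_nneseries => [k _ _|k _]; first exact: a0.
  have [_ _ hk] := HV k; apply: le_trans hk.
  by apply: le_mu => // u [].
have W0 x : (0 <= W x)%E by exact: nneseries_ge0.
have Wfin x : W x \is a fin_num.
  by rewrite ge0_fin_numE// (le_lt_trans (W1 x))// ltry.
have Wnd x y : x <= y -> (W x <= W y)%E.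
  move=> xy; apply: lee_nneseries => // k _.
  apply: le_mu => //; apply: setIS.
  exact: subset_itvl.
exists (fine \o W); first split.
- by move=> x y xy /=; rewrite fine_le// Wnd.
- by move=> x /=; rewrite fine_ge0//= -lee_fin fineK.
move=> t c /NB Bt.
have [K cK] : exists K : nat, c <= K%:R.
  by exists (Num.truncn c).+1; rewrite ltW// truncnS_gt.
(* Finitely many open sets containing [t] share a neighbourhood of [t], which contains [[t, s]] once
   [s] is close to [t]. *)
have : \forall s \near t, forall k, (k < K)%N -> V k s.
  elim: {cK} K => [|K IH]; first by exists 1 => //= s _ k.
  near=> s => k; rewrite ltnS leq_eqVlt => /predU1P[->|].
    near: s; apply: open_nbhs_nbhs; split => //.
    by case: (HV K) => _ + _; exact.
  by move: k; near: s.
move=> [d /= d0 Hd].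
near=> s.
have ts : t < s by [].
have sd : s - t < d by near: s; exact: nbhs_right_ltDr.
have Vin k x : (k < K)%N -> x \in `[t, s] -> V k x.
  move=> kK; rewrite in_itv /= => /andP[tx xs]; apply: Hd => //=.
  by rewrite /ball /= distrC ger0_norm ?subr_ge0//; lra.
have step k : (k < K)%N -> (a k t + (s - t)%:E <= a k s)%E.
  move=> kK.
  have -> : (s - t)%:E = mu `]t, s].
    by rewrite lebesgue_measure_itv/= lte_fin ts.
  have -> : (a k t + mu `]t, s])%E = mu ((V k `&` `]-oo, t]) `|` `]t, s]).
    rewrite measureU//; first exact: mVx.
    rewrite -classical_sets.subset0 => x [[_ /=]].
    by rewrite !in_itv/= => xt; rewrite ltNge xt.
  apply: le_mu => //; first by apply: measurableU => //; exact: mVx.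
  move=> x [[Vx]|] /=; rewrite !in_itv/=.
    by move=> xt; split => //; rewrite (le_trans xt)// ltW.
  move=> /andP[tx xs]; split => //.
  by apply: Vin => //; rewrite in_itv/= xs ltW.
suff : (K%:R * (s - t) <= fine (W s) - fine (W t)).
  by apply: le_trans; rewrite ler_wpM2r// subr_ge0 ltW.
rewrite lerBrDl -lee_fin EFinD !fineK// /W.
(* The first [K] terms gain [s - t] each; the tail is monotone in the endpoint. *)
rewrite (nneseries_split 0 K)// [leRHS](nneseries_split 0 K)// add0n addeAC.
apply: leeD; last first.
  apply: lee_nneseries => // k _; apply: le_mu => //.
  by apply: setIS; apply: subset_itvl; rewrite bnd_simp ltW.
rewrite !big_mkord.
have -> : (K%:R * (s - t))%:E = (\sum_(k < K) (s - t)%:E)%E.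
  by rewrite sumEFin sumr_const card_ord mulr_natl.
by rewrite -big_split/=; apply: lee_sum => k _; exact: step.
Unshelve. all: by end_near. Qed.
End RightGrowth.

Section UpperFTC.
Context {R : realType}.
Notation mu := (@lebesgue_measure R).

Lemma derivable_right_increment (F : R -> R) (t e : R) :
  derivable F t 1 -> 0 < e ->
  \forall s \near t^'+, (F^`()%classic t - e) * (s - t) <= F s - F t.
Proof.
move=> dF e0; apply/nbhs_right0P.
have Fq : h^-1 *: ((F \o shift t) (h *: 1) - F t) @[h --> 0^'+] -->
    F^`()%classic t.
  by rewrite derive1E; apply: cvg_dnbhs_at_right; exact: dF.
near=> h; have h0 : 0 < h by [].
rewrite [t + h]addrC addrK -ler_pdivlMr// [leRHS]mulrC.
have -> : h + t = (shift t) (h *: 1) by rewrite /= [h *: 1]mulr1.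
by near: h; apply: (cvgr_ge _ Fq); rewrite ltrBlDr ltrDl.
Unshelve. all: by end_near. Qed.

(* Off a null set the integral of [phi] has derivative [phi]; on that null set
   the increment of [V] is absorbed by a small multiple of a monotone function
   with infinite derivative there. *)
Lemma right_derivative_le_integral (V v phi : R -> R) (T M : R) : 0 <= T ->
  mu.-integrable setT (EFin \o phi) -> (forall t, - M <= phi t) ->
  (forall t : R, 0 <= t < T ->
     (s - t)^-1 * (V s - V t) @[s --> t^'+] --> v t) ->
  (forall t : R, 0 < t <= T -> V s @[s --> t^'-] --> V t) ->
  {ae mu, forall t, 0 <= t -> v t <= phi t} ->
  V T - V 0 <= \int[mu]_(t in `[0, T]) phi t.
Proof.
move=> T0 iphi phiM Vr Vl vphi.
have FilterMu := ae_filter_ringOfSetsType mu.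
pose F x := \int[mu]_(t in `[0, x]) phi t.
have iphiS (A : set R) : measurable A -> mu.-integrable A (EFin \o phi).
  by move=> mA; apply: integrableS iphi.
have locphi : locally_integrable [set: R] phi.
  by apply: open_integrable_locally => //; exact: openT.
pose FTC x := 0 < x -> derivable F x 1 /\ F^`()%classic x = phi x.
have dF : {ae mu, forall x : R, FTC x}.
  apply: filterS
    (FTC1 (a := BLeft 0) (fun y => iphiS _ (measurable_itv _)) locphi).
  by move=> x; rewrite lte_fin.
(* [FTC 0] is vacuous, so the origin joins the exceptional null set. *)
have n0 : {ae mu, forall x : R, x != 0}.
  exists [set 0]; split; [exact: measurable_set1|exact: lebesgue_measure_set1|].
  by move=> x /= /negP; rewrite negbK => /eqP.
have [g [gnd g01] gN] := negligible_growth (filterI n0 (filterI dF vphi)).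
(* At exceptional times nothing is known about the derivative of [F]; the lower bound on [phi] still
   limits its decrease to rate [M]. *)
have FB (s t : R) : 0 <= t -> t <= s -> - M * (s - t) <= F s - F t.
  move=> t0 ts; rewrite /F Rintegral_itvB ?bnd_simp//; last exact: iphiS.
  have mu_ts : mu `]t, s] = (s - t)%:E.
    rewrite lebesgue_measure_itv/= lte_fin -EFinD.
    have [//|st] := ltP t s.
    by have -> : s = t; [apply/le_anti/andP|rewrite subrr].
  have -> : - M * (s - t) = \int[mu]_(x in `]t, s]) (- M).
    by rewrite Rintegral_cst// [X in fine X](_ : _ = (s - t)%:E).
  apply: le_Rintegral => //; last exact: iphiS.
  apply/integrableP; split; first exact: measurable_cst.
  have -> : (\int[mu]_(x in `]t, s]) `|(EFin \o (fun=> - M)%R) x| =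
      `|(- M)%:E| * mu `]t, s])%E.
    by rewrite -(@integral_cst _ _ _ mu).
  by rewrite mu_ts -EFinM ltry.
apply/ler_addgt0Pr => eps eps0.
(* The error splits into [eta] for the total growth of [eta * g] and [2 * eta] per unit of time from
   the difference quotients. *)
pose eta := eps / (1 + 2 * T).
have T1 : 0 < 1 + 2 * T by rewrite ltr_pwDl// mulr_ge0.
have eta0 : 0 < eta by rewrite divr_gt0.
have -> : eps = eta + 2 * eta * T by rewrite /eta; field; rewrite gt_eqF.
pose f x := V x - F x - eta * g x.
suff : f T <= f 0 + 2 * eta * T.
  rewrite /f {2}/F set_itv1 Rintegral_set1 -/(F T).
  have /andP[g0 _] := g01 0; have /andP[_ gT] := g01 T.
  have : eta * g T <= eta by rewrite ler_piMr// ltW.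
  have : 0 <= eta * g 0 by rewrite mulr_ge0// ltW.
  lra.
apply: right_growth_le => //; first by rewrite mulr_ge0 ?ltW.
- move=> t /andP[t0 tT].
  have Vt e : 0 < e -> \forall s \near t^'+, V s - V t <= (v t + e) * (s - t).
    move=> e0; have : v t < v t + e by rewrite ltrDl.
    move=> /(cvgr_le _ (Vr t _)); rewrite t0 tT => /(_ isT) H.
    near=> s; have ts : t < s by [].
    by rewrite -ler_pdivrMr ?subr_gt0// mulrC; near: s.
  (* At an exceptional time [V - F] grows at rate at most [v t + 1 + M], which is absorbed by
     [eta * g]; elsewhere [F] has derivative [phi t], which is at least [v t]. *)
  have [Nt|] := pselect
      ((~` [set x | x != 0 /\ (FTC x /\ (0 <= x -> v x <= phi x))]) t).
    near=> s; have ts : t < s by [].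
    have : V s - V t <= (v t + 1) * (s - t) by near: s; exact: Vt.
    have : (v t + 1 + M) / eta * (s - t) <= g s - g t by near: s; exact: gN.
    rewrite -(ler_pM2l eta0) mulrA mulrCA mulfV ?gt_eqF// mulr1.
    have := FB s t t0 (ltW ts).
    have : 0 <= eta * (s - t) by rewrite mulr_ge0 ?ltW// subr_gt0.
    rewrite /f; lra.
  move=> /contrapT[tn0 [Ft vt]].
  have {tn0} tp : 0 < t by rewrite lt_neqAle eq_sym tn0.
  have {Ft}[dFt Ft] := Ft tp; have {}vt := vt t0.
  have Fr : \forall s \near t^'+, (phi t - eta) * (s - t) <= F s - F t.
    by rewrite -Ft; exact: derivable_right_increment.
  near=> s; have ts : t < s by [].
  have : V s - V t <= (v t + eta) * (s - t) by near: s; exact: Vt.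
  have : (phi t - eta) * (s - t) <= F s - F t by near: s.
  have : eta * g t <= eta * g s by rewrite ler_pM2l// gnd// ltW.
  have : v t * (s - t) <= phi t * (s - t) by rewrite ler_wpM2r// subr_ge0 ltW.
  rewrite /f; lra.
(* [V] and [F] are continuous from the left, and [- eta * g] is nonincreasing, so it can only jump
   down. *)
- move=> t e /andP[t0 tT] e0.
  have Fc : F s @[s --> t^'-] --> F t.
    apply: cvg_at_left_filter.
    have T1' : 0 < T + 1 by rewrite ltr_wpDl.
    have := parameterized_integral_continuous (ltW T1')
      (iphiS _ (measurable_itv _)).
    move=> /(continuous_within_itvP _ T1')[+ _ _]; apply.
    by rewrite in_itv/= t0 (le_lt_trans tT)// ltrDl.
  have e2 : 0 < e / 2 by rewrite divr_gt0.
  have Vn : \forall s \near t^'-, `|V t - V s| <= e / 2.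
    have /cvgrPdist_le : V s @[s --> t^'-] --> V t by apply: Vl; rewrite t0.
    exact.
  have Fn : \forall s \near t^'-, `|F t - F s| <= e / 2.
    by move/cvgrPdist_le : Fc; exact.
  near=> s; have st : s < t by [].
  have : V t - V s <= e / 2 by apply: le_trans (ler_norm _) _; near: s.
  have : - (F t - F s) <= e / 2.
    by apply: le_trans (ler_norm _) _; rewrite normrN; near: s.
  have : eta * g s <= eta * g t by rewrite ler_pM2l// gnd// ltW.
  rewrite /f; lra.
Unshelve. all: by end_near. Qed.
End UpperFTC.

Section EnergyInequality.
Context {R : realType}.
Notation mu := (@lebesgue_measure R).

(** The one-sided bound is applied on [[0, n]] to [a W - b min(Q, n)], which is at least [- b n].
    Since [V n >= 0 = V 0], the truncated integrals of [Q] are bounded uniformly in [n], and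
    monotone convergence concludes. *)
Lemma energy_integral_le (V v W Q : R -> R) (a b : R) : 0 <= a -> 0 < b ->
  V 0 = 0 -> (forall t : R, 0 <= t -> 0 <= V t) ->
  (forall t : R, 0 <= t -> (s - t)^-1 * (V s - V t) @[s --> t^'+] --> v t) ->
  (forall t : R, 0 < t -> V s @[s --> t^'-] --> V t) ->
  measurable_fun setT W -> measurable_fun setT Q ->
  (forall t : R, 0 <= W t) -> (forall t : R, 0 <= Q t) ->
  (\int[mu]_(t in `[0%R, +oo[) (W t)%:E < +oo)%E ->
  {ae mu, forall t, 0 <= t -> v t <= a * W t - b * Q t} ->
  (\int[mu]_(t in `[0%R, +oo[) (Q t)%:E <=
   (a / b)%:E * \int[mu]_(t in `[0%R, +oo[) (W t)%:E)%E.
Proof.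
move=> a0 b0 V0 Vge0 Vr Vl mW mQ W0 Q0 Woo vle.
have FilterMu := ae_filter_ringOfSetsType mu.
pose D : set R := `[0, +oo[%classic.
have mD : measurable D by exact: measurable_itv.
have Dge0 t : 0 <= t -> D t by move=> t0; rewrite /D/= in_itv/= t0.
pose WD := W \_ D.
have iW : mu.-integrable D (EFin \o W).
  apply/integrableP; split.
    by apply/measurable_EFinP; exact: measurable_funTS.
  by under eq_integral do rewrite /= ger0_norm//.
have iWD : mu.-integrable setT (EFin \o WD).
  by move: iW; rewrite integrable_mkcond// restrict_EFin.
pose I (n : nat) : set R := `[0, n%:R]%classic.
have mI n : measurable (I n) by exact: measurable_itv.
have muI n : (mu (I n) < +oo)%E.
  by rewrite lebesgue_measure_itv/=; case: ifP => _; rewrite -?EFinD ltry.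
pose Qn n t := Num.min (Q t) n%:R.
have mQn n : measurable_fun setT (Qn n) by exact: measurable_minr.
have Qn0 n t : 0 <= Qn n t by rewrite le_min Q0 ler0n.
have Qnn n t : Qn n t <= n%:R by rewrite ge_min lexx orbT.
have iQn n : mu.-integrable (I n) (EFin \o Qn n).
  apply: measurable_bounded_integrable.
  - exact: mI.
  - exact: muI.
  - by apply: measurable_funS (mQn n).
  - exists n%:R; split; first exact: num_real.
    by move=> M nM t _ /=; rewrite ger0_norm// (le_trans (Qnn n t))// ltW.
(* One index serves as time horizon and as truncation level, so [q n] is nondecreasing in [n] and,
   at each time in [D], eventually equals [Q]. *)
pose q n := Qn n \_ (I n).
have iq n : mu.-integrable setT (EFin \o q n).
  by have mIn := mI n; move: (iQn n); rewrite integrable_mkcond// restrict_EFin.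
pose phi n t := a * WD t - b * q n t.
have iaW : mu.-integrable setT (EFin \o (fun t => a * WD t)).
  exact: (integrableZl measurableT a iWD).
have ibq n : mu.-integrable setT (EFin \o (fun t => b * q n t)).
  exact: (integrableZl measurableT b (iq n)).
have iphi n : mu.-integrable setT (EFin \o phi n).
  exact: (integrableB measurableT iaW (ibq n)).
have WD0 t : 0 <= WD t by rewrite /WD patchE; case: ifP.
have q0 n t : 0 <= q n t by rewrite /q patchE; case: ifP.
have qn n t : q n t <= n%:R by rewrite /q patchE; case: ifP.
have key n : (\int[mu]_(t in I n) (Qn n t)%:E <=
    (a / b)%:E * \int[mu]_(t in D) (W t)%:E)%E.
  have : V n%:R - V 0 <= \int[mu]_(t in I n) phi n t.
    apply: (right_derivative_le_integral (v := v) (M := b * n%:R)) => //.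
    - move=> t; rewrite /phi; have : b * q n t <= b * n%:R by rewrite ler_pM2l.
      by have : 0 <= a * WD t by [exact: mulr_ge0]; lra.
    - by move=> t /andP[t0 _]; exact: Vr.
    - by move=> t /andP[t0 _]; exact: Vl.
    - apply: filterS vle => t /[swap] t0 /(_ t0) /le_trans; apply.
      rewrite /phi /WD patchE mem_set//; last exact: Dge0.
      rewrite lerD2l lerN2 ler_pM2l// /q patchE; case: ifP => // _.
      by rewrite ge_min lexx.
  rewrite V0 subr0 => /(le_trans (Vge0 _ (ler0n _ n))).
  have iS (A : set R) f : measurable A ->
      mu.-integrable setT (EFin \o f) -> mu.-integrable A (EFin \o f).
    by move=> mA; exact: integrableS.
  have mIn := mI n.
  rewrite RintegralB//; [|exact: (iS _ _ mIn iaW)|exact: (iS _ _ mIn (ibq n))].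
  rewrite RintegralZl//; last exact: (iS _ _ mIn iWD).
  rewrite RintegralZl//; last exact: (iS _ _ mIn (iq n)).
  rewrite subr_ge0 -ler_pdivlMl// mulrA (mulrC b^-1).
  have -> : \int[mu]_(t in I n) q n t = \int[mu]_(t in I n) Qn n t.
    by apply: eq_Rintegral => t tI; rewrite /q patchE tI.
  have WW : (\int[mu]_(t in I n) (WD t)%:E <= \int[mu]_(t in D) (W t)%:E)%E.
    have -> : (\int[mu]_(t in I n) (WD t)%:E = \int[mu]_(t in I n) (W t)%:E)%E.
      apply: eq_integral => t; rewrite inE /I/= in_itv/= => /andP[t0 _].
      by rewrite /WD patchE mem_set//; exact: Dge0.
    apply: ge0_subset_integral => //.
    - by apply/measurable_EFinP; exact: measurable_funTS.
    - by move=> t _; rewrite lee_fin.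
    - by apply: subset_itvl.
  rewrite -lee_fin /Rintegral EFinM !fineK; first last.
  - exact: (integrable_fin_num _ (iQn n)).
  - exact: (integrable_fin_num _ (iS _ _ mIn iWD)).
  move=> /le_trans; apply; apply: lee_wpmul2l => //.
  by rewrite lee_fin divr_ge0// ltW.
have Qlim (t : R) : D t -> (q n t)%:E @[n --> \oo] --> (Q t)%:E.
  move=> Dt; apply: cvg_near_cst; near=> n; congr EFin.
  rewrite /q patchE ifT; last first.
    rewrite inE /I/= in_itv/=; move: Dt; rewrite /D/= in_itv/= => /andP[-> _]/=.
    by near: n; exact: nbhs_infty_ger.
  by apply/min_idPl; near: n; exact: nbhs_infty_ger.
have mq n : measurable_fun D (fun t => (q n t)%:E).
  by apply: measurable_funS (measurable_int _ (iq n)).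
have q0e n t : D t -> (0 <= (q n t)%:E)%E by move=> _; rewrite lee_fin.
have qnd (t : R) : D t ->
    {homo (fun n => (q n t)%:E) : m n / (m <= n)%N >-> (m <= n)%E}.
  move=> _ m n mn; rewrite lee_fin /q !patchE.
  case: ifPn => tm; last by case: ifP.
  rewrite ifT; last first.
    move: tm; rewrite !inE /I/= !in_itv/= => /andP[-> /le_trans]; apply.
    by rewrite ler_nat.
  by rewrite le_min ge_min lexx/= (le_trans (Qnn m t)) ?ler_nat.
have cvQ := @cvg_monotone_convergence _ _ R mu D mD _ mq q0e qnd.
have -> : (\int[mu]_(t in D) (Q t)%:E =
    \int[mu]_(t in D) limn (fun n => (q n t)%:E))%E.
  by apply: eq_integral => t; rewrite inE => /Qlim /cvg_lim ->.
rewrite -(cvg_lim _ cvQ)//; apply: lime_le.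
  by apply/cvg_ex; eexists; exact: cvQ.
apply: nearW => n; apply: le_trans (key n).
rewrite [leLHS](_ : _ =
    \int[mu]_(t in D) ((EFin \o Qn n) \_ (I n)) t)%E; last first.
  by apply: eq_integral => t _; rewrite restrict_EFin.
rewrite -integral_mkcondr (_ : D `&` I n = I n)//; apply/setIidPr.
exact: subset_itvl.
Unshelve. all: by end_near. Qed.
End EnergyInequality.

(** * Lebesgue measurability and L2 norms *)

Section LebesgueMeasurable.
Context {R : realType}.
Notation mu := (@lebesgue_measure R).
Variables (D : set R) (mD : measurable D).

Lemma lebesgue_measurableW (f : R -> R) :
  measurable_fun D f -> lebesgue_measurable_fun D f.
Proof. by move=> mf; exists f => //; exact: ae_eq_refl. Qed.

Lemma eq_lebesgue_measurable (f g : R -> R) : (forall t, D t -> f t = g t) ->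
  lebesgue_measurable_fun D g -> lebesgue_measurable_fun D f.
Proof.
have FilterMu := ae_filter_ringOfSetsType mu.
move=> fg [h mh gh]; exists h => //; apply: filterS gh => t ght Dt.
by rewrite fg// ght.
Qed.

Lemma lebesgue_measurableD (f g : R -> R) :
  lebesgue_measurable_fun D f -> lebesgue_measurable_fun D g ->
  lebesgue_measurable_fun D (f \+ g).
Proof.
have FilterMu := ae_filter_ringOfSetsType mu.
move=> [f' mf ff] [g' mg gg]; exists (f' \+ g'); first exact: measurable_funD.
by apply: filterS2 ff gg => t ff gg Dt /=; rewrite ff// gg.
Qed.

Lemma lebesgue_measurableZ c (f : R -> R) :
  lebesgue_measurable_fun D f -> lebesgue_measurable_fun D (fun t => c * f t).
Proof.
have FilterMu := ae_filter_ringOfSetsType mu.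
move=> [f' mf ff]; exists (fun t => c * f' t).
  by apply: measurable_funM => //; exact: measurable_cst.
by apply: filterS ff => t ff Dt /=; rewrite ff.
Qed.

Lemma lebesgue_measurable_sum (I : Type) (s : seq I) (f : I -> R -> R) :
  (forall i, lebesgue_measurable_fun D (f i)) ->
  lebesgue_measurable_fun D (fun t => \sum_(i <- s) f i t).
Proof.
move=> mf; elim: s => [|i s IH].
  apply: (eq_lebesgue_measurable (g := cst 0)) => [t _|].
    by rewrite big_nil.
  by apply: lebesgue_measurableW; exact: measurable_cst.
apply: (eq_lebesgue_measurable (g := f i \+ (fun t => \sum_(i <- s) f i t))).
  by move=> t _; rewrite big_cons.
exact: lebesgue_measurableD.
Qed.

(** The countably many exceptional sets lie in one null set [N]; the Borel representatives, set to
    zero on [N], converge everywhere on [D]. *)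
Lemma lebesgue_measurable_cvg (f_ : nat -> R -> R) (f : R -> R) :
  (forall n, lebesgue_measurable_fun D (f_ n)) ->
  (forall t, D t -> f_ n t @[n --> \oo] --> f t) ->
  lebesgue_measurable_fun D f.
Proof.
move=> mf fcvg.
have /choice[h /all_and2[mh fh]] n : exists h,
    measurable_fun D h /\ ae_eq mu D (f_ n) h.
  by have [h] := mf n; exists h.
have [N [mN N0 fhN]] := ae_foralln fh.
pose k n := h n \_ (~` N).
exists (f \_ (~` N)).
  apply: (measurable_fun_cvg (h := k)) => [n|t Dt].
    rewrite /k; apply/measurable_restrict => //; first exact: measurableC.
    by apply: measurable_funS (mh n) => // t [].
  rewrite /k patchE; case: ifPn => [|] tN; last first.
    by under eq_fun do rewrite patchE (negbTE tN); exact: cvg_cst.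
  under eq_fun do rewrite patchE tN.
  have tP : forall n, D t -> f_ n t = h n t.
    by apply: contrapT => /fhN; move: tN; rewrite inE.
  apply: cvg_trans (fcvg _ Dt); apply: near_eq_cvg.
  by apply: nearW => n; rewrite tP.
exists N; split => // t /= /not_implyP[Dt].
by rewrite patchE; case: ifPn => //; rewrite notin_setE /= => /contrapT.
Qed.
End LebesgueMeasurable.

Section NonmeasurableIntegral.
Context {R : realType}.
Notation mu := (@lebesgue_measure R).
Local Open Scope ereal_scope.
Import HBNNSimple.

(* The integral of a nonnegative function is a supremum over simple functions
   below it, even if the function is not Borel; such suprema do not see null
   sets. *)
Lemma ge0_ae_le_integral_nonmeasurable (D : set R) (f g : R -> \bar R) :
  (forall t, D t -> 0 <= f t) -> (forall t, D t -> 0 <= g t) ->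
  {ae mu, forall t, D t -> f t <= g t} ->
  \int[mu]_(t in D) f t <= \int[mu]_(t in D) g t.
Proof.
move=> f0 g0 [N [mN N0 fgN]].
rewrite !ge0_integralE//; apply: ge_ereal_sup => _ [h /= hf <-].
have mNC : measurable (~` N) by exact: measurableC.
(* Cutting [h] to zero on [N] keeps its integral and puts it below [g] on all of [D]. *)
have -> : sintegral mu h = sintegral mu (proj_nnsfun h mNC).
  rewrite -integralT_nnsfun (ge0_negligible_integral _ _ _ _ N0)//.
  - by rewrite setTD integral_nnsfun// mrestrict.
  - exact/measurable_EFinP.
  - by move=> t _; rewrite lee_fin.
apply: le_ereal_sup_tmp; exists (sintegral mu (proj_nnsfun h mNC)) => //.
exists (proj_nnsfun h mNC) => //= t.
rewrite -[X in X%:E]/(proj_nnsfun h mNC t) -mrestrict patchE.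
case: ifPn => [|_]; last by rewrite patchE; case: ifPn => // /set_mem /g0.
rewrite inE /= => tN; apply: le_trans (hf t) _; rewrite !patchE.
case: ifPn => // /set_mem Dt.
by apply: contrapT => fg; apply: tN; apply: fgN => /=; move=> /(_ Dt).
Qed.

Lemma ge0_ae_eq_integral_nonmeasurable (D : set R) (f g : R -> \bar R) :
  (forall t, D t -> 0 <= f t) -> (forall t, D t -> 0 <= g t) ->
  ae_eq mu D f g -> \int[mu]_(t in D) f t = \int[mu]_(t in D) g t.
Proof.
have FilterMu := ae_filter_ringOfSetsType mu.
move=> f0 g0 fg; apply/eqP; rewrite eq_le; apply/andP; split.
all: apply: ge0_ae_le_integral_nonmeasurable => //.
all: by apply: filterS fg => t fg Dt; rewrite fg.
Qed.

End NonmeasurableIntegral.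

Section L2Gain.
Context {R : realType}.
Notation mu := (@lebesgue_measure R).
Let D : set R := `[0, +oo[%classic.

Lemma dotcv_ge0 n (u : 'cV[R]_n) : 0 <= dotcv u u.
Proof. by apply: sumr_ge0 => i _; rewrite -expr2 sqr_ge0. Qed.

Lemma sqr_enorm n (u : 'cV[R]_n) : enorm u ^+ 2 = dotcv u u.
Proof. by rewrite /enorm sqr_sqrtr// dotcv_ge0. Qed.

Lemma L2normE n (f : R -> 'cV[R]_n) :
  L2norm f = ((\int[mu]_(t in D) (dotcv (f t) (f t))%:E) `^ 2^-1)%E.
Proof.
rewrite /L2norm unlock; congr (_ `^ _)%E.
rewrite [RHS]integral_mkcond; apply: eq_integral => t _.
rewrite !patchE; case: ifPn => _ /=.
  by rewrite powR_mulrn ?normr_ge0// ger0_norm ?sqrtr_ge0// sqr_enorm.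
by rewrite normr0 powR0.
Qed.

(** Supplies the functions, Borel on the whole line, that [energy_integral_le] takes, from signals
    that are only Lebesgue measurable on the half-line. *)
Lemma borel_sqr_norm n (f : R -> 'cV[R]_n) :
  (forall i, lebesgue_measurable_fun D (fun t => f t i ord0)) ->
  exists W : R -> R, [/\ measurable_fun setT W, forall t, 0 <= W t &
    {ae mu, forall t, D t -> dotcv (f t) (f t) = W t}].
Proof.
have FilterMu := ae_filter_ringOfSetsType mu.
have mD : measurable D by exact: measurable_itv.
move=> mf.
have /choice[h /all_and2[mh fh]] i : exists h, measurable_fun D h /\
    ae_eq mu D (fun t => f t i ord0) h.
  by have [h] := mf i; exists h.
exists (fun t => \sum_i (h i \_ D) t ^+ 2); split.
- apply: measurable_sum => i; apply: measurable_funX.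
  by apply/(measurable_restrictT _ mD).
- by move=> t; apply: sumr_ge0 => i _; rewrite sqr_ge0.
- have := @filter_forall _ _ _ _ FilterMu fh; apply: filterS => t fht Dt.
  by apply: eq_bigr => i _; rewrite patchE mem_set// fht// expr2.
Qed.

(** A dissipation inequality with supply rate [a |w|^2 - b |z|^2] gives the gain [sqrt (a / b)]:
    pass to Borel representatives of both squares, integrate, take square roots. Finiteness of the
    norm of [z] comes out of the estimate. *)
Lemma L2_gain n m (w : R -> 'cV[R]_n) (z : R -> 'cV[R]_m) (V v : R -> R)
    (a b : R) : 0 <= a -> 0 < b ->
  in_L2 w -> (forall i, lebesgue_measurable_fun D (fun t => z t i ord0)) ->
  V 0 = 0 -> (forall t : R, 0 <= t -> 0 <= V t) ->
  (forall t : R, 0 <= t -> (s - t)^-1 * (V s - V t) @[s --> t^'+] --> v t) ->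
  (forall t : R, 0 < t -> V s @[s --> t^'-] --> V t) ->
  (forall t : R, 0 <= t ->
     v t <= a * dotcv (w t) (w t) - b * dotcv (z t) (z t)) ->
  in_L2 z /\ (L2norm z <= (Num.sqrt (a / b))%:E * L2norm w)%E.
Proof.
move=> a0 b0 [mw woo] mz V0 Vge0 Vr Vl vle.
have FilterMu := ae_filter_ringOfSetsType mu.
suff zw : (L2norm z <= (Num.sqrt (a / b))%:E * L2norm w)%E.
  split=> //; split => //; apply: le_lt_trans zw _.
  by rewrite lte_mul_pinfty// lee_fin sqrtr_ge0.
have [W [mW W0 wW]] := borel_sqr_norm mw.
have [Q [mQ Q0 zQ]] := borel_sqr_norm mz.
have D0 t : D t -> 0 <= t by rewrite /D/= in_itv/= andbT.
have intE k (f : R -> 'cV[R]_k) F : (forall t, 0 <= F t) ->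
    {ae mu, forall t, D t -> dotcv (f t) (f t) = F t} ->
    (\int[mu]_(t in D) (dotcv (f t) (f t))%:E = \int[mu]_(t in D) (F t)%:E)%E.
  move=> F0 fF; apply: ge0_ae_eq_integral_nonmeasurable => [t _|t _|].
  - by rewrite lee_fin dotcv_ge0.
  - by rewrite lee_fin.
  - by apply: filterS fF => t fF Dt; rewrite fF.
have ab0 : 0 <= a / b by rewrite divr_ge0// ltW.
(* An infinite integral would have an infinite square root, against the finiteness of the norm of
   [w]. *)
have Woo : (\int[mu]_(t in D) (W t)%:E < +oo)%E.
  rewrite -(intE _ _ _ W0 wW); move: woo; rewrite L2normE.
  set I := (\int[mu]_(t in D) _)%E.
  have : (0 <= I)%E by apply: integral_ge0 => t _; rewrite lee_fin dotcv_ge0.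
  by case: I => [r| |] //=; rewrite ?ltry// invr_eq0 pnatr_eq0.
have := energy_integral_le a0 b0 V0 Vge0 Vr Vl mW mQ W0 Q0 Woo.
have -> : ((Num.sqrt (a / b))%:E * L2norm w =
   ((a / b)%:E * \int[mu]_(t in D) (W t)%:E) `^ 2^-1)%E.
  rewrite L2normE (intE _ _ _ W0 wW) poweRM ?lee_fin ?poweR_EFin ?powR12_sqrt//.
  by apply: integral_ge0 => t _; rewrite lee_fin.
rewrite L2normE (intE _ _ _ Q0 zQ) => QW.
apply: gt0_ler_poweR; rewrite ?invr_gt0//.
- by rewrite in_itv/= leey andbT; apply: integral_ge0 => t _; rewrite lee_fin.
- rewrite in_itv/= leey andbT mule_ge0 ?lee_fin//.
  by apply: integral_ge0 => t _; rewrite lee_fin.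
apply: QW; apply: filterS2 wW zQ => t wW zQ t0.
have Dt : D t by rewrite /D/= in_itv/= t0.
by rewrite -wW// -zQ//; exact: vle.
Qed.

End L2Gain.

(** * Trajectories *)

Section Paths.
Context {R : realType}.
Notation mu := (@lebesgue_measure R).
Let D : set R := `[0, +oo[%classic.
Local Notation ge0 := [set s : R | 0 <= s].

Section Filters.
Context {T : topologicalType}.
Implicit Types (f : R -> T) (t : R) (l : T).

Lemma cvg_ge0_at_right f t l : 0 <= t ->
  f s @[s --> within ge0 t^'] --> l -> f s @[s --> t^'+] --> l.
Proof.
move=> t0; apply: cvg_trans; apply: cvg_app => P [e /= e0 He].
exists e => //= s ste ts; apply: He => //=; first by rewrite gt_eqF.
by rewrite (le_trans t0)// ltW.
Qed.

Lemma cvg_ge0_at_left f t l : 0 < t ->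
  f s @[s --> within ge0 t^'] --> l -> f s @[s --> t^'-] --> l.
Proof.
move=> t0; apply: cvg_trans; apply: cvg_app => P [e /= e0 He].
exists (Num.min e t) => /= [|s ste ts]; first by rewrite lt_min e0.
have [se st] : `|t - s| < e /\ `|t - s| < t.
  by move: ste; rewrite /ball/= lt_min => /andP[].
apply: He => //=; first by rewrite lt_eqF.
by move: st; rewrite ltr_norml => /andP[_]; rewrite ltrBlDr ltrDl => /ltW.
Qed.

Lemma cvg_ge0_seq f t l :
  f s @[s --> within ge0 t^'] --> l -> 0 <= t ->
  f (t + n.+1%:R^-1) @[n --> \oo] --> l.
Proof.
move=> fl t0; apply: cvg_comp fl => P [e /= e0 He].
near=> n; apply: He => /=.
- rewrite opprD addNKr normrN gtr0_norm ?invr_gt0//.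
  by near: n; exact: (near_infty_natSinv_lt (PosNum e0)).
- by rewrite gt_eqF// ltrDl invr_gt0.
- by rewrite addr_ge0.
Unshelve. all: by end_near. Qed.

End Filters.

Lemma ge0_continuous_measurable (f : R -> R) :
  (forall t : R, 0 <= t -> f s @[s --> within ge0 t^'] --> f t) ->
  measurable_fun D f.
Proof.
move=> fc; have mD : measurable D by exact: measurable_itv.
apply: subspace_continuous_measurable_fun => //.
apply/subspace_continuousP => t; rewrite {1}/D/= in_itv/= andbT => t0.
apply/cvgrPdist_lt => e e0.
have /cvgrPdist_lt /(_ _ e0) [d /= d0 Hd] := fc _ t0.
exists d => //= s sd; rewrite /D/= in_itv/= andbT => s0.
by have [->|st] := eqVneq s t; [rewrite subrr normr0|exact: Hd].
Qed.

Section Derivative.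
Context {Z : hilbertType R}.
Variables (x v : R -> Z).
Hypothesis xv : forall t : R, 0 <= t -> has_deriv_ge0 x t (v t).

Lemma has_deriv_ge0_cvg (t : R) : 0 <= t -> x s @[s --> within ge0 t^'] --> x t.
Proof.
move=> t0; pose q s := (s - t)^-1 *: (x s - x t).
have id0 : (s - t) @[s --> within ge0 t^'] --> (0 : R).
  rewrite -[X in _ --> X](subrr t); apply: cvgB; last exact: cvg_cst.
  by apply: cvg_within_filter; apply: cvg_within_filter; exact: cvg_id.
have : x t + (s - t) *: q s @[s --> within ge0 t^'] --> x t.
  rewrite -[X in _ --> X]addr0 -[X in _ + X](scale0r (v t)).
  by apply: cvgD; [exact: cvg_cst|apply: cvgZ => //; exact: xv].
apply: cvg_trans; apply: near_eq_cvg.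
exists 1 => //= s _ /= st s0; rewrite /q scalerA divff ?subr_eq0// scale1r.
by rewrite addrC subrK.
Qed.

(** The Lipschitz bound is asked along the trajectory, to suit operators whose bounds are known on
    [X] only. *)
Lemma lipschitz_cvg {W : normedModType R} (f : R -> W) (M t : R) :
  (forall s : R, 0 <= s -> `|f s - f t| <= M * `|x s - x t|) -> 0 <= t ->
  f s @[s --> within ge0 t^'] --> f t.
Proof.
move=> fM t0; apply/cvgrPdist_lt => e e0.
have M1 : 0 < `|M| + 1 by rewrite ltr_wpDl.
have /cvgrPdist_lt /(_ _ (divr_gt0 e0 M1)) := has_deriv_ge0_cvg t0.
move=> [d /= d0 Hd]; exists d => //= s sd st s0.
have := Hd s sd st s0; rewrite ltr_pdivlMr// => h.
rewrite distrC; apply: le_lt_trans (fM _ s0) (le_lt_trans _ h).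
by rewrite distrC mulrC ler_wpM2l// (le_trans (ler_norm M))// lerDl.
Qed.

Section QuadraticForm.
Variables (h : R -> Z) (M : R).
Hypothesis h_lip : forall s t : R, 0 <= s -> 0 <= t ->
  `|h s - h t| <= M * `|x s - x t|.
Hypothesis h_sym : forall s t : R, 0 <= s -> 0 <= t ->
  '<x s, h t> = '<h s, x t>.

Lemma quadratic_form_cvg (t : R) : 0 <= t ->
  '<x s, h s> @[s --> within ge0 t^'] --> '<x t, h t>.
Proof.
move=> t0; apply: cvg_inner; first exact: has_deriv_ge0_cvg.
by apply: (lipschitz_cvg (M := M)) => // s s0; exact: h_lip.
Qed.

(** By symmetry the increment is [<x s - x t, h s + h t>]; dividing by [s - t], the derivative of
    [x] and the continuity of [h] give the limit. *)
Lemma quadratic_form_deriv (t : R) : 0 <= t ->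
  (s - t)^-1 * ('<x s, h s> - '<x t, h t>) @[s --> within ge0 t^'] -->
  2 * '<v t, h t>.
Proof.
move=> t0.
have hc : h s @[s --> within ge0 t^'] --> h t.
  by apply: (lipschitz_cvg (M := M)) => // s s0; exact: h_lip.
have : '<(s - t)^-1 *: (x s - x t), h s + h t> @[s --> within ge0 t^'] -->
    '<v t, h t + h t>.
  by apply: cvg_inner; [exact: xv|apply: cvgD => //; exact: cvg_cst].
have -> : '<v t, h t + h t> = 2 * '<v t, h t> by rewrite innerDr; ring.
apply: cvg_trans; apply: near_eq_cvg.
exists 1 => //= s _ /= st s0.
rewrite innerZl innerBl !innerDr (h_sym s0 t0) (innerC (h s)); congr (_ * _).
by ring.
Qed.

End QuadraticForm.

Lemma lipschitz_functional_measurable (f : R -> R) (M : R) :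
  (forall s t : R, 0 <= s -> 0 <= t -> `|f s - f t| <= M * `|x s - x t|) ->
  lebesgue_measurable_fun D f.
Proof.
move=> fM; apply: lebesgue_measurableW.
apply: ge0_continuous_measurable => t t0.
by apply: (lipschitz_cvg (M := M)) => // s s0; exact: fM.
Qed.

(** The derivative is the pointwise limit of forward difference quotients with steps [1 / (n + 1)],
    each continuous in [t] because [x] is. *)
Lemma derivative_inner_measurable (g : Z) :
  lebesgue_measurable_fun D (fun t => '<v t, g>).
Proof.
pose y c t := '<x (t + c), g>.
have my c : 0 <= c -> measurable_fun D (y c).
  move=> c0; apply: ge0_continuous_measurable => t t0.
  apply: cvg_inner; last exact: cvg_cst.
  apply/cvgrPdist_lt => e e0.
  have /cvgrPdist_lt /(_ _ e0) := has_deriv_ge0_cvg (addr_ge0 t0 c0).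
  move=> [d /= d0 Hd]; exists d => //= s sd st s0.
  apply: Hd => /=; last by rewrite addr_ge0.
    by rewrite opprD addrACA subrr addr0.
  by rewrite (inj_eq (addIr _)).
pose f_ n t := n.+1%:R * (y n.+1%:R^-1 t - y 0 t).
have mD : measurable D by exact: measurable_itv.
apply: (lebesgue_measurable_cvg mD (f_ := f_)).
  move=> n; apply: lebesgue_measurableW.
  apply: measurable_funM; first exact: measurable_cst.
  by apply: measurable_funB; apply: my; rewrite ?invr_ge0.
move=> t; rewrite /D/= in_itv/= andbT => t0.
have : '<(s - t)^-1 *: (x s - x t), g> @[s --> within ge0 t^'] --> '<v t, g>.
  by apply: cvg_inner; [exact: xv|exact: cvg_cst].
move=> /cvg_ge0_seq/(_ t0); apply: cvg_trans; apply: near_eq_cvg.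
apply: nearW => n; rewrite /f_ /y addr0 innerZl innerBl; congr (_ * _).
by rewrite addrAC subrr add0r invrK.
Qed.

End Derivative.

Lemma scalar_cvE n (l : 'cV[R]_n -> R) :
  (forall (a : R) u v, l (a *: u + v) = a * l u + l v) ->
  forall u, l u = \sum_i u i ord0 * l (delta_mx i ord0).
Proof.
move=> lin u.
have l0 : l 0 = 0.
  by have := lin 1 0 0; rewrite scale1r addr0 mul1r; lra.
rewrite [in LHS](matrix_sum_delta u).
under eq_bigr do rewrite big_ord1.
have addl : {morph l : a b / a + b >-> a + b}.
  by move=> a b; rewrite -[a in LHS]scale1r lin mul1r.
rewrite (big_morph l addl l0); apply: eq_bigr => i _.
by rewrite -[_ *: _]addr0 lin l0 addr0.
Qed.

Lemma linear_input_measurable n (w : R -> 'cV[R]_n) (l : 'cV[R]_n -> R) :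
  (forall (a : R) u v, l (a *: u + v) = a * l u + l v) ->
  (forall i, lebesgue_measurable_fun D (fun t => w t i ord0)) ->
  lebesgue_measurable_fun D (fun t => l (w t)).
Proof.
move=> lin mw.
apply: (eq_lebesgue_measurable
  (g := fun t => \sum_i l (delta_mx i ord0) * w t i ord0)) => [t _|].
  by rewrite (scalar_cvE lin); apply: eq_bigr => i _; rewrite mulrC.
by apply: lebesgue_measurable_sum => i; exact: lebesgue_measurableZ.
Qed.

End Paths.

(** * Measurability of outputs under possibly unbounded operators *)

Section Outputs.
Context {R : realType}.

Lemma submodB (V : lmodType R) (X : submodClosed V) (u v : V) :
  u \in X -> v \in X -> u - v \in X.
Proof. by move=> uX vX; rewrite -scaleN1r rpredD ?rpredZ. Qed.

Lemma linear_onB (V W : lmodType R) (X : {pred V}) (f : V -> W) (u v : V) :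
  linear_on X f -> u \in X -> v \in X -> f (u - v) = f u - f v.
Proof.
by move=> lin uX vX; rewrite addrC -scaleN1r lin// scaleN1r addrC.
Qed.

Lemma op_invK (Z : hilbertType R) (P : Z -> Z) :
  injective P -> cancel P (op_inv P).
Proof. by move=> Pinj x; apply: pinvKV; rewrite ?inE// => u v _ _ /Pinj. Qed.

Lemma dotcvDl n (u v w : 'cV[R]_n) : dotcv (u + v) w = dotcv u w + dotcv v w.
Proof. by rewrite -big_split/=; apply: eq_bigr => i _; rewrite mxE mulrDl. Qed.

Lemma dotcvC n (u v : 'cV[R]_n) : dotcv u v = dotcv v u.
Proof. by apply: eq_bigr => i _; rewrite mulrC. Qed.

Lemma dotcvDr n (u v w : 'cV[R]_n) : dotcv w (u + v) = dotcv w u + dotcv w v.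
Proof. by rewrite !(dotcvC w) dotcvDl. Qed.

Lemma dotcvZl n c (u w : 'cV[R]_n) : dotcv (c *: u) w = c * dotcv u w.
Proof. by rewrite [RHS]mulr_sumr; apply: eq_bigr => i _; rewrite mxE mulrA. Qed.

(** The expression [- g |v|^2 + 2 v . c] is maximal at [v = c / g], with value [|c|^2 / g]. *)
Lemma quadratic_sup n (g S B : R) (c : 'cV[R]_n) : 0 < g ->
  (forall v, S - g * enorm v ^+ 2 + dotcv v c + dotcv c v <= B) ->
  S + g^-1 * dotcv c c <= B.
Proof.
move=> g0 /(_ (g^-1 *: c)).
rewrite sqr_enorm !(dotcvC c) !dotcvZl (dotcvC c) dotcvZl.
by rewrite mulVKf ?gt_eqF// subrK.
Qed.

(** Each coordinate of [C] is dominated by the dissipation form, so [riesz_sequence] approximates it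
    by measurable functions. The plant state takes for [T] the inverse of [P1]; the error takes
    [T = id], with [P2] made part of [G]. *)
Lemma output_measurable (Z : hilbertType R) (X : submodClosed Z) n
    (G T : Z -> Z) (C : Z -> 'cV[R]_n) (g M : R) (x v : R -> Z) : 0 < g ->
  linear_on X G -> linear_on X T -> linear_on X C ->
  (forall u, u \in X -> `|T u| <= M * `|u|) ->
  (forall u, u \in X -> 2 * '<G u, T u> + g^-1 * dotcv (C u) (C u) <= 0) ->
  (forall t : R, 0 <= t -> x t \in X) ->
  (forall t : R, 0 <= t -> has_deriv_ge0 x t (v t)) ->
  (forall k, k \in X ->
     lebesgue_measurable_fun `[0, +oo[ (fun t => '<G (x t), T k>)) ->
  forall i, lebesgue_measurable_fun `[0, +oo[ (fun t => C (x t) i ord0).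
Proof.
move=> g0 Glin Tlin Clin TM dissip xX xv mG i.
have mD : measurable (`[0, +oo[%classic : set R) by exact: measurable_itv.
(* The polarized dissipation form: [dissip] reads [|C u|^2 <= g * a u u], which makes [a]
   nonnegative and dominates every coordinate of [C]. *)
pose a k u := - ('<G u, T k> + '<G k, T u>).
pose f u := C u i ord0.
have f_le u : u \in X -> f u ^+ 2 <= g * a u u.
  move=> uX; have := dissip u uX; rewrite -(ler_pM2l g0) mulrDr mulr0.
  rewrite mulVKf ?gt_eqF//.
  have : f u ^+ 2 <= dotcv (C u) (C u).
    rewrite /dotcv (bigD1 i)//= -expr2 lerDl.
    by apply: sumr_ge0 => j _; rewrite -expr2 sqr_ge0.
  by rewrite /a; lra.
have a_ge0 u : u \in X -> 0 <= a u u.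
  by move=> uX; have := le_trans (sqr_ge0 _) (f_le u uX); rewrite pmulr_rge0.
have aC k u : a k u = a u k by rewrite /a addrC.
have alin k : k \in X -> linear_on X (a ^~ k : Z -> R^o).
  move=> kX c u u' uX u'X; rewrite /a Glin// Tlin//.
  by rewrite !(innerDr, innerDl, innerZr, innerZl) /GRing.scale/=; ring.
have flin : linear_on X (f : Z -> R^o).
  by move=> c u u' uX u'X; rewrite /f Clin// !mxE.
have [k kX kf] := riesz_sequence aC alin flin f_le a_ge0 (ltW g0).
(* For fixed [m], [a (k m) (x t)] has one term covered by [mG] and one that is a bounded functional
   of [T (x t)], hence continuous in [t]. *)
apply: (lebesgue_measurable_cvg mD (f_ := fun n t => a (k n) (x t))) => [m|t].
  apply: (eq_lebesgue_measurable (g := fun t =>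
      -1 * ('<G (x t), T (k m)> + '<G (k m), T (x t)>))) => [t _|].
    by rewrite mulN1r.
  apply: lebesgue_measurableZ; apply: lebesgue_measurableD; first exact: mG.
  apply: (lipschitz_functional_measurable xv
    (M := `|G (k m)| * M)) => s t s0 t0.
  rewrite -innerBr -mulrA.
  rewrite -(linear_onB Tlin) ?xX//.
  have dX : x s - x t \in X by rewrite submodB ?xX.
  apply: le_trans (_ : `|G (k m)| * `|T (x s - x t)| <= _).
    exact: ler_norm_inner.
  by rewrite ler_wpM2l// TM.
by rewrite /= in_itv/= andbT => t0; exact: kf (xX _ t0).
Qed.

End Outputs.

(** * Dissipation inequalities for the closed loop *)

Theorem theorem4 (R : realType) (Z U Y : hilbertType R) (X : submodClosed Z)
  (nw p p1 : nat)
  (A : Z -> Z) (B1 : {linear 'cV[R]_nw -> Z}) (B2 : {linear U -> Z})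
  (C1 : Z -> 'cV[R]_p) (C2 : Z -> Y) (C3 : Z -> 'cV[R]_p1)
  (D1 : {linear 'cV[R]_nw -> 'cV[R]_p}) (D2 : {linear 'cV[R]_nw -> Y})
  (D3 : {linear 'cV[R]_nw -> 'cV[R]_p1})
  (A_lin : linear_on X A) (C1_lin : linear_on X C1)
  (C2_lin : linear_on X C2) (C3_lin : linear_on X C3)
  (eps1 eps2 gamma1 gamma2 : R)
  (eps1_gt0 : 0 < eps1) (eps2_gt0 : 0 < eps2)
  (gamma1_gt0 : 0 < gamma1) (gamma2_gt0 : 0 < gamma2)
  (P1 : {linear Z -> Z}) (H : Z -> U)
  (P1_bounded : bounded_op P1) (P1_coercive : coercive P1)
  (P1_adjoint : self_adjoint P1) (P1_X : P1 @` [set` X] = [set` X])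
  (H_lin : linear_on X H)
  (ineq1 : forall (h : Z) (w : 'cV[R]_nw) (v : 'cV[R]_p), h \in X ->
     '<A (P1 h), h> + '<h, A (P1 h)> + '<B2 (H h), h> + '<h, B2 (H h)>
     + '<B1 w, h> + '<h, B1 w>
     - gamma1 * enorm w ^+ 2 - gamma1 * enorm v ^+ 2
     + dotcv v (C1 (P1 h)) + dotcv (C1 (P1 h)) v
     + dotcv v (D1 w) + dotcv (D1 w) v
     <= - eps1 * `|h| ^+ 2)
  (P2 : {linear Z -> Z}) (Zop : {linear Y -> Z})
  (P2_bounded : bounded_op P2) (Zop_bounded : bounded_op Zop)
  (P2_coercive : coercive P2)
  (P2_adjoint : self_adjoint P2)
  (ineq2 : forall (e : Z) (w : 'cV[R]_nw) (v : 'cV[R]_p1), e \in X ->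
     '<P2 (A e) + Zop (C2 e), e> + '<e, P2 (A e) + Zop (C2 e)>
     - '<e, P2 (B1 w) + Zop (D2 w)> - '<P2 (B1 w) + Zop (D2 w), e>
     - gamma2 * enorm w ^+ 2 - gamma2 * enorm v ^+ 2
     + dotcv v (C3 e) + dotcv (C3 e) v
     + dotcv v (D3 w) + dotcv (D3 w) v
     <= - eps2 * `|e| ^+ 2)
  (r : R) (r_gt0 : 0 < r)
  (ineq3 : forall h e : Z, h \in X -> e \in X ->
     - eps1 * `|h| ^+ 2
     + '<h, B2 (H (op_inv P1 e))> + '<B2 (H (op_inv P1 e)), h>
     - r * eps2 * `|e| ^+ 2 <= 0) :
  let K : Z -> U := fun x => H (op_inv P1 x) in
  let L : Y -> Z := fun y => op_inv P2 (Zop y) in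
  forall (w : R -> 'cV[R]_nw) (x e : R -> Z) (z : R -> 'cV[R]_p) (y : R -> Y)
    (ze : R -> 'cV[R]_p1),
  in_L2 w ->
  (forall t, 0 <= t -> x t \in X) ->
  (forall t, 0 <= t -> e t \in X) ->
  (forall t, 0 <= t ->
     has_deriv_ge0 x t (A (x t) + B2 (K (x t)) + B1 (w t) + B2 (K (e t)))) ->
  (forall t, 0 <= t ->
     has_deriv_ge0 e t
       (A (e t) + L (C2 (e t)) - (B1 (w t) + L (D2 (w t))))) ->
  (forall t, 0 <= t -> z t = C1 (x t) + D1 (w t)) ->
  (forall t, 0 <= t -> y t = C2 (x t) + D2 (w t)) ->
  (forall t, 0 <= t -> ze t = C3 (e t) + D3 (w t)) ->
  x 0 = 0 -> e 0 = 0 ->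
  (in_L2 z /\
   L2norm z <= (Num.sqrt (gamma1 * (gamma1 + r * gamma2)))%:E * L2norm w)%E /\
  (in_L2 ze /\ L2norm ze <= gamma2%:E * L2norm w)%E.
Proof.
move=> K L w x e z y ze wL2 xX eX x_deriv e_deriv zE _ zeE x0 e0.
have mw := wL2.1.
have P1inj := coercive_inj P1_coercive.
have P2inj := coercive_inj P2_coercive.
pose T := op_inv P1.
have TP1 : cancel P1 T by exact: op_invK.
(* Lax-Milgram makes [P2] surjective, so [op_inv P2] is a right inverse as well. *)
have P2L u : P2 (L u) = Zop u.
  have [q qE] := coercive_surj (Zop u) P2_bounded P2_coercive.
  by rewrite /L -qE op_invK.
(* [P1] maps [X] onto itself, so its inverse [T] preserves [X]. *)
have TX u : u \in X -> T u \in X /\ P1 (T u) = u.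
  move=> uX; have : [set` X] u by [].
  by rewrite -P1_X => -[h /= hX <-]; rewrite TP1.
have Tlin : linear_on X T.
  move=> c u v /TX[_ uE] /TX[_ vE].
  by rewrite -{1}uE -{1}vE -linearP TP1.
(* Coercivity at [T u] reads [eps |T u|^2 <= <T u, u> <= |T u| |u|]. *)
have [M1 T_le] : exists M, forall u, u \in X -> `|T u| <= M * `|u|.
  have [eps eps0 P1_ge] := P1_coercive.
  exists eps^-1 => u /TX[_ uE]; rewrite -ler_pdivrMl ?invr_gt0// invrK.
  have [->|Tu0] := eqVneq (T u) 0; first by rewrite normr0 mulr0.
  have Tu : 0 < `|T u| by rewrite normr_gt0.
  rewrite -(ler_pM2r Tu) -mulrA -expr2 (le_trans (P1_ge (T u) I))// uE mulrC.
  exact: ler_inner_norm.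
have Klin : linear_on X K.
  by move=> c u v uX vX; rewrite /K -/T Tlin// H_lin//; exact: (TX _ _).1.
pose G1 u := A u + B2 (K u).
have G1lin : linear_on X G1.
  move=> c u v uX vX; rewrite /G1 A_lin// Klin// linearP scalerDr.
  by rewrite addrACA.
pose G2 u := P2 (A u) + Zop (C2 u).
have G2lin : linear_on X G2.
  move=> c u v uX vX; rewrite /G2 A_lin// C2_lin// !linearP scalerDr.
  by rewrite addrACA.
(* This is [ineq1] at [h = T u], where [P1 h = u], maximized over the multiplier [v]. *)
have ineq1' u (b : 'cV[R]_nw) : u \in X ->
    2 * '<G1 u + B1 b, T u> - gamma1 * dotcv b b
    + gamma1^-1 * dotcv (C1 u + D1 b) (C1 u + D1 b) <= - eps1 * `|T u| ^+ 2.
  move=> uX; have [TuX uE] := TX _ uX.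
  apply: quadratic_sup => // v; have := ineq1 (T u) b v TuX.
  rewrite uE -[H (T u)]/(K u) sqr_enorm dotcvDl dotcvDr /G1 !innerDl.
  rewrite !(innerC (T u)); lra.
have ineq2' u (b : 'cV[R]_nw) : u \in X ->
    2 * '<G2 u - (P2 (B1 b) + Zop (D2 b)), u> - gamma2 * dotcv b b
    + gamma2^-1 * dotcv (C3 u + D3 b) (C3 u + D3 b) <= - eps2 * `|u| ^+ 2.
  move=> uX.
  apply: quadratic_sup => // v; have := ineq2 u b v uX.
  rewrite sqr_enorm dotcvDl dotcvDr innerBl.
  rewrite !(innerC u) -/(G2 u); lra.
(* Applying [P2] to the error equation clears the inverse hidden in [L]. *)
have P2e (t : R) : P2 (A (e t) + L (C2 (e t)) - (B1 (w t) + L (D2 (w t)))) =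
    G2 (e t) - (P2 (B1 (w t)) + Zop (D2 (w t))).
  by rewrite linearB !linearD /= !P2L.
have [M2 P2_le] := P2_bounded.
have K0 : K 0 = 0.
  have := Klin 1 0 0 (rpred0 X) (rpred0 X).
  by rewrite !scale1r addr0 => /esym/eqP; rewrite -subr_eq0 addrK => /eqP.
have KZ c u : u \in X -> K (c *: u) = c *: K u.
  by move=> uX; have := Klin c u 0 uX (rpred0 X); rewrite K0 !addr0.
(* [ineq3] is invariant under [h -> s h, e -> e / s], so it bounds the coupling
   term by a multiple of [|e|] although [B2 K] itself may be unbounded. *)
have coupling g u : g \in X -> u \in X ->
    `|'<B2 (K u), g>| <= (eps1 * `|g| ^+ 2 + r * eps2) / 2 * `|u|.
  move=> gX uX.
  have [->|u0] := eqVneq u 0.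
    by rewrite K0 linear0 inner0l !normr0 mulr0.
  have un : 0 < `|u| by rewrite normr_gt0.
  (* [ineq3] is tested at [g] and the unit vector along [u], with either sign [c]. *)
  have half c : `|c| = 1 ->
      c * '<B2 (K u), g> <= (eps1 * `|g| ^+ 2 + r * eps2) / 2 * `|u|.
    move=> c1; have cuX : (c / `|u|) *: u \in X by rewrite rpredZ.
    have := ineq3 g _ gX cuX; rewrite -/(K _) KZ// linearZ /= innerZr innerZl.
    rewrite (innerC g) normrZ normrM c1 mul1r normfV normr_id mulVf ?gt_eqF//.
    rewrite -ler_pdivrMr// mulrAC; lra.
  rewrite ler_norml; apply/andP; split.
    by rewrite lerNl -mulN1r half// normrN1.
  by rewrite -[leLHS]mul1r half// normr1.
have dot00 n : dotcv (0 : 'cV[R]_n) 0 = 0.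
  by apply: big1 => i _; rewrite mxE mul0r.
have mz : forall i, lebesgue_measurable_fun `[0, +oo[ (fun t => z t i ord0).
  move=> i; apply: (eq_lebesgue_measurable (g := fun t =>
      C1 (x t) i ord0 + (D1 (w t)) i ord0)) => [t|].
    by rewrite /= in_itv/= andbT => t0; rewrite zE// mxE.
  apply: lebesgue_measurableD; last first.
    apply: (linear_input_measurable (l := fun u => D1 u i ord0)) => // c u v.
    by rewrite linearP !mxE.
  apply: (output_measurable gamma1_gt0 G1lin Tlin C1_lin T_le _ xX x_deriv).
    move=> u uX; have := ineq1' u 0 uX.
    rewrite !linear0 !addr0 dot00 mulr0 subr0 => /le_trans; apply.
    by rewrite mulNr oppr_le0 mulr_ge0 ?sqr_ge0// ltW.
  move=> k kX.
  (* [G1 (x t)] is the derivative of [x] minus the input and coupling terms; by [coupling], the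
     coupling term tested against [T k] is Lipschitz along [e]. *)
  apply: (eq_lebesgue_measurable (g := fun t =>
    '<A (x t) + B2 (K (x t)) + B1 (w t) + B2 (K (e t)), T k>
    + (-1 * '<B1 (w t), T k> + -1 * '<B2 (K (e t)), T k>))) => [t _|].
    by rewrite !innerDl; ring.
  apply: lebesgue_measurableD.
    exact: derivative_inner_measurable x_deriv _.
  apply: lebesgue_measurableD; apply: lebesgue_measurableZ.
    apply: (linear_input_measurable (l := fun u => '<B1 u, T k>)) => // c u v.
    by rewrite linearP innerPl.
  apply: (lipschitz_functional_measurable e_deriv
    (M := (eps1 * `|T k| ^+ 2 + r * eps2) / 2)) => s t s0 t0.
  have dX : e s - e t \in X by rewrite submodB ?eX.
  have -> : '<B2 (K (e s)), T k> - '<B2 (K (e t)), T k> =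
      '<B2 (K (e s - e t)), T k>.
    by rewrite -innerBl -linearB (linear_onB Klin) ?eX.
  by apply: coupling => //; exact: (TX _ _).1.
have mze : forall i, lebesgue_measurable_fun `[0, +oo[ (fun t => ze t i ord0).
  move=> i; apply: (eq_lebesgue_measurable (g := fun t =>
      C3 (e t) i ord0 + (D3 (w t)) i ord0)) => [t|].
    by rewrite /= in_itv/= andbT => t0; rewrite zeE// mxE.
  apply: lebesgue_measurableD; last first.
    apply: (linear_input_measurable (l := fun u => D3 u i ord0)) => // c u v.
    by rewrite linearP !mxE.
  apply: (output_measurable (T := id) (M := 1)
    gamma2_gt0 G2lin _ C3_lin _ _ eX e_deriv).
  - by [].
  - by move=> u _; rewrite mul1r.
  - move=> u uX; have := ineq2' u 0 uX.
    rewrite !linear0 !addr0 subr0 dot00 mulr0 subr0 => /le_trans; apply.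
    by rewrite mulNr oppr_le0 mulr_ge0 ?sqr_ge0// ltW.
  move=> k kX.
  (* [G2 (e t)] is [P2] applied to the derivative of [e], plus an input term; self-adjointness moves
     [P2] onto the fixed vector [k]. *)
  apply: (eq_lebesgue_measurable (g := fun t =>
    '<A (e t) + L (C2 (e t)) - (B1 (w t) + L (D2 (w t))), P2 k>
    + '<P2 (B1 (w t)) + Zop (D2 (w t)), k>)) => [t _|].
    by rewrite -P2_adjoint P2e -innerDl subrK.
  apply: lebesgue_measurableD.
    exact: derivative_inner_measurable e_deriv _.
  apply: (linear_input_measurable
    (l := fun u => '<P2 (B1 u) + Zop (D2 u), k>)) => // c u v.
  rewrite !linearP addrACA -scalerDr innerPl//.
have lipT (s t : R) : 0 <= s -> 0 <= t ->
    `|T (x s) - T (x t)| <= M1 * `|x s - x t|.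
  move=> s0 t0.
  by rewrite -(linear_onB Tlin) ?T_le ?submodB ?xX.
(* On [X], [T] inherits its symmetry from [P1] through [u = P1 (T u)]. *)
have symT (s t : R) : 0 <= s -> 0 <= t -> '<x s, T (x t)> = '<T (x s), x t>.
  move=> /xX/TX[_ sE] /xX/TX[_ tE].
  by rewrite -{1}sE -{2}tE P1_adjoint.
have lipP2 (s t : R) : 0 <= s -> 0 <= t ->
    `|P2 (e s) - P2 (e t)| <= M2 * `|e s - e t|.
  by move=> _ _; rewrite -linearB.
have symP2 (s t : R) : 0 <= s -> 0 <= t -> '<e s, P2 (e t)> = '<P2 (e s), e t>.
  by rewrite P2_adjoint.
pose V1 (t : R) := '<x t, T (x t)>; pose V2 (t : R) := '<e t, P2 (e t)>.
pose v1 (t : R) :=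
  2 * '<A (x t) + B2 (K (x t)) + B1 (w t) + B2 (K (e t)), T (x t)>.
pose v2 (t : R) :=
  2 * '<A (e t) + L (C2 (e t)) - (B1 (w t) + L (D2 (w t))), P2 (e t)>.
have V2_ge0 (t : R) : 0 <= V2 t.
  have [eps eps0 /(_ (e t) I)] := P2_coercive; apply: le_trans.
  by rewrite mulr_ge0 ?sqr_ge0// ltW.
have V1_ge0 (t : R) : 0 <= t -> 0 <= V1 t.
  move=> /xX/TX[_ tE]; rewrite /V1 -{1}tE innerC.
  have [eps eps0 /(_ (T (x t)) I)] := P1_coercive; apply: le_trans.
  by rewrite mulr_ge0 ?sqr_ge0// ltW.
have V1c (t : R) : 0 <= t ->
    V1 s @[s --> within [set s : R | 0 <= s] t^'] --> V1 t.
  exact: (quadratic_form_cvg (h := T \o x) x_deriv lipT).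
have V2c (t : R) : 0 <= t ->
    V2 s @[s --> within [set s : R | 0 <= s] t^'] --> V2 t.
  exact: (quadratic_form_cvg (h := P2 \o e) e_deriv lipP2).
have V1d (t : R) : 0 <= t -> (s - t)^-1 * (V1 s - V1 t)
    @[s --> within [set s : R | 0 <= s] t^'] --> v1 t.
  exact: (quadratic_form_deriv (h := T \o x) x_deriv lipT symT).
have V2d (t : R) : 0 <= t -> (s - t)^-1 * (V2 s - V2 t)
    @[s --> within [set s : R | 0 <= s] t^'] --> v2 t.
  exact: (quadratic_form_deriv (h := P2 \o e) e_deriv lipP2 symP2).
have V10 : V1 0 = 0 by rewrite /V1 x0 inner0l.
have V20 : V2 0 = 0 by rewrite /V2 e0 inner0l.
(* The term [- eps2 |e|^2] is kept, as it helps to absorb the coupling in [v1_le]. *)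
have v2_le (t : R) : 0 <= t -> v2 t <= gamma2 * dotcv (w t) (w t)
    - gamma2^-1 * dotcv (ze t) (ze t) - eps2 * `|e t| ^+ 2.
  move=> t0; have := ineq2' (e t) (w t) (eX _ t0).
  by rewrite -zeE// -P2e P2_adjoint /v2; lra.
(* [ineq3] at [T (x t)] and [e t] bounds the coupling term [2 <B2 K e, T x>] by
   [eps1 |T x|^2 + r eps2 |e|^2], which [ineq1'] and [r] times [v2_le] supply with the opposite
   sign. The contribution of [ze] has a favourable sign and is dropped. *)
have v1_le (t : R) : 0 <= t -> v1 t + r * v2 t <=
    (gamma1 + r * gamma2) * dotcv (w t) (w t) - gamma1^-1 * dotcv (z t) (z t).
  move=> t0; have := ineq1' (x t) (w t) (xX _ t0); rewrite -zE//.
  have := ineq3 _ _ (TX _ (xX _ t0)).1 (eX _ t0).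
  rewrite -/(K _) (innerC (T _)) /v1 [in X in _ -> _ -> X]innerDl -/(G1 _).
  have := v2_le t t0; rewrite -(ler_pM2l r_gt0).
  have : 0 <= r * (gamma2^-1 * dotcv (ze t) (ze t)).
    by rewrite !mulr_ge0 ?invr_ge0 ?dotcv_ge0// ltW.
  lra.
split.
- have -> : gamma1 * (gamma1 + r * gamma2) = (gamma1 + r * gamma2) / gamma1^-1.
    by rewrite invrK mulrC.
  apply: (L2_gain (V := fun t => V1 t + r * V2 t)
    (v := fun t => v1 t + r * v2 t)) => //.
  + by rewrite addr_ge0 ?mulr_ge0// ltW.
  + by rewrite invr_gt0.
  + by rewrite V10 V20 mulr0 addr0.
  + by move=> t t0; rewrite addr_ge0 ?V1_ge0// mulr_ge0// ltW.
  + move=> t t0; apply: cvg_ge0_at_right => //.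
    have -> : (fun s => (s - t)^-1 * (V1 s + r * V2 s - (V1 t + r * V2 t))) =
        (fun s => (s - t)^-1 * (V1 s - V1 t) +
          r * ((s - t)^-1 * (V2 s - V2 t))).
      by apply/funext => s; ring.
    by apply: cvgD; [exact: V1d|apply: cvgMl_tmp; exact: V2d].
  + move=> t t0; apply: cvg_ge0_at_left => //.
    by apply: cvgD; [exact: V1c (ltW t0)|apply: cvgMl_tmp; exact: V2c (ltW t0)].
- have -> : gamma2 = Num.sqrt (gamma2 / gamma2^-1).
    by rewrite invrK -expr2 sqrtr_sqr gtr0_norm.
  apply: (L2_gain (V := V2) (v := v2)) => //.
  + exact: ltW.
  + by rewrite invr_gt0.
  + by move=> t t0; apply: cvg_ge0_at_right => //; exact: V2d.
  + by move=> t t0; apply: cvg_ge0_at_left => //; exact: V2c (ltW t0).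
  + move=> t t0; apply: le_trans (v2_le t t0) _.
    by rewrite gerBl mulr_ge0 ?sqr_ge0// ltW.
Qed.
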